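(* Let $A=(a,b,c,d)$ with $a,b,c,d\in\mathbb{R}$, $ad-bc=1$, $b\neq0$. Let $f,g\in L^2(\mathbb{R})$ be nonzero such that $tf(t),\,tg(t)\in L^2(\mathbb{R})$ and $uL_A^f(u),\,uL_A^g(u)\in L^2(\mathbb{R})$. Then the time and frequency spreads of the STLCT $S^A_gf$ satisfy $$T^2_{A,S}\,F^2_{A,S}\ \ge\ |b|^2 .$$
   Context: For a real matrix parameter $M=(a,b,c,d)$ with $ad-bc=1$ and $b\neq0$, the LCT of $h\in L^2(\mathbb{R})$ is $L_M^{h}(u)=\int h(t)K_M(t,u)\,dt$ with $K_M(t,u)=\frac{1}{\sqrt{i2\pi b}}\exp\!\big(i\frac{a}{2b}t^2-i\frac{1}{b}tu+i\frac{d}{2b}u^2\big)$. For a window $g\in L^2(\mathbb{R})$, the STLCT of $f$ is $S^{A}_{g}f(t,u)=\int f(\tau)\overline{g(\tau-t)}K_A(\tau,u)\,d\tau$. With $\|S\|^2=\iint|S^A_gf(t,u)|^2dt\,du$: $\overline{t_{A,S}}=\frac{1}{\|S\|^2}\iint t|S^A_gf|^2dt\,du$, $\overline{u_{A,S}}=\frac{1}{\|S\|^2}\iint u|S^A_gf|^2dt\,du$, $T^2_{A,S}=\frac{1}{\|S\|^2}\iint (t-\overline{t_{A,S}})^2|S^A_gf(t,u)|^2dt\,du$, $F^2_{A,S}=\frac{1}{\|S\|^2}\iint (u-\overline{u_{A,S}})^2|S^A_gf(t,u)|^2dt\,du$. *)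

(* Defs.v *)
From HB Require Import structures.
From mathcomp Require Import all_boot all_order all_algebra.
From mathcomp Require Import all_classical all_reals all_analysis.
From mathcomp Require Import complex.
Set Implicit Arguments.
Unset Strict Implicit.
Unset Printing Implicit Defensive.
Import Order.TTheory GRing.Theory Num.Theory.
Import numFieldNormedType.Exports.
Local Open Scope classical_set_scope.
Local Open Scope ring_scope.

Section STLCT.
Variable R : realType.
Local Notation C := R[i].
Local Notation mu := (@lebesgue_measure R).

Definition cmod (z : C) : R := Normc.normc z.

Definition cint (h : R -> C) : C :=
  ((Rintegral mu setT (fun t => complex.Re (h t)))
   +i* (Rintegral mu setT (fun t => complex.Im (h t))))%C.

Definition L2 (h : R -> C) : Prop :=
  measurable_fun setT (fun t => complex.Re (h t)) /\
  measurable_fun setT (fun t => complex.Im (h t)) /\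
  (\int[mu]_t ((cmod (h t)) ^+ 2)%:E < +oo)%E.

Definition L2norm2 (h : R -> C) : \bar R := (\int[mu]_t ((cmod (h t)) ^+ 2)%:E)%E.

Definition expi (x : R) : C := (cos x +i* sin x)%C.

(* LCT kernel K_M(t,u) = 1/sqrt(i 2 pi b) exp(i a/(2b) t^2 - i/b t u + i d/(2b) u^2),
   with the principal square root sqrtc *)
Definition LCTkernel (a b d : R) (t u : R) : C :=
  (sqrtc ((2 * pi * b) *i)%C)^-1 *
  expi (a / (2 * b) * t ^+ 2 - t * u / b + d / (2 * b) * u ^+ 2).

Definition LCT (a b c d : R) (h : R -> C) (u : R) : C :=
  cint (fun t => h t * LCTkernel a b d t u).

Definition STLCT (a b c d : R) (g f : R -> C) (p : R * R) : C :=
  cint (fun tau => f tau * conjc (g (tau - p.1)) * LCTkernel a b d tau p.2).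

Local Notation mu2 := ((mu \x mu)%E).

Definition dint (F : R * R -> R) : R := Rintegral mu2 setT F.

Definition Snorm2 (a b c d : R) (g f : R -> C) : R :=
  dint (fun p => (cmod (STLCT a b c d g f p)) ^+ 2).

Definition tmean (a b c d : R) (g f : R -> C) : R :=
  dint (fun p => p.1 * (cmod (STLCT a b c d g f p)) ^+ 2) / Snorm2 a b c d g f.

Definition umean (a b c d : R) (g f : R -> C) : R :=
  dint (fun p => p.2 * (cmod (STLCT a b c d g f p)) ^+ 2) / Snorm2 a b c d g f.

Definition Tspread2 (a b c d : R) (g f : R -> C) : R :=
  dint (fun p => (p.1 - tmean a b c d g f) ^+ 2 * (cmod (STLCT a b c d g f p)) ^+ 2)
  / Snorm2 a b c d g f.

Definition Fspread2 (a b c d : R) (g f : R -> C) : R :=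
  dint (fun p => (p.2 - umean a b c d g f) ^+ 2 * (cmod (STLCT a b c d g f p)) ^+ 2)
  / Snorm2 a b c d g f.

End STLCT.

(* Main.v *)
Require Import Defs.
From HB Require Import structures.
From mathcomp Require Import all_boot all_order all_algebra.
From mathcomp Require Import all_classical all_reals all_analysis.
From mathcomp Require Import measurable_realfun complex.
From mathcomp Require Import ring lra.

(** Plancherel's theorem turns the quantities attached to the short-time
    transform into integrals over the plane.  With the chirped signal
    [G x = expi (a / (2 b) x^2) f x] and the substitution [t = x - s], the
    energy [|S|^2] weighted by a function of [t] is [|f x|^2 |g s|^2] weighted
    by a function of [x - s], while the weight [2 - 2 cos ((u - u0) r / b)] on
    the frequency side is the squared [L^2] norm of the increment
    [expi ph * Phi (x + r, s + r) - Phi (x, s)] of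
    [Phi (x, s) = G x * conjc (g s)], where [ph = - u0 r / b].  Since
    [2 - 2 cos y <= y^2], the frequency spread bounds that increment by
    [O(r^2)].  The time spread about any point is at least [V f + V g], the sum
    of the variances of [|f|^2] and [|g|^2], which is also the variance of
    [x + s] under [|Phi|^2].  Translating by [(r, r)] moves the mean of [x + s]
    by [2 r]; comparing this with the increment through a weighted
    Cauchy-Schwarz inequality and letting [r] tend to [0] gives the uncertainty
    inequality without differentiating anything.

    Plancherel's theorem is proved by damping with [expR (- e |u|)]: for a
    nonnegative [p] the kernel [1 + cos] is nonnegative, so Tonelli's theorem
    applies and produces the Poisson kernel, which is an approximate identity;
    the parallelogram law then removes the sign restriction. *)

Set Implicit Arguments.
Unset Strict Implicit.
Unset Printing Implicit Defensive.
Import Order.TTheory GRing.Theory Num.Theory.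
Import numFieldNormedType.Exports.
Local Open Scope classical_set_scope.
Local Open Scope ring_scope.

(** * Integrals of nonnegative functions *)

Lemma measurable_cos (R : realType) : measurable_fun [set: R] (@cos R).
Proof. apply: continuous_measurable_fun; exact: continuous_cos. Qed.

Lemma measurable_sin (R : realType) : measurable_fun [set: R] (@sin R).
Proof. apply: continuous_measurable_fun; exact: continuous_sin. Qed.

Ltac meas := repeat first
  [ assumption
  | exact: measurable_cst
  | exact: measurable_id
  | exact: measurable_fst
  | exact: measurable_snd
  | match goal with
    | |- measurable_fun _ (fun x => EFin _) => apply/measurable_EFinP
    | |- measurable_fun _ (EFin \o _) => apply/measurable_EFinP
    | |- measurable_fun _ (fun x => _ + _) => apply: measurable_funD
    | |- measurable_fun ?D (GRing.add ?z) => change (measurable_fun D (fun x => z + x))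
    | |- measurable_fun ?D (GRing.mul ?z) => change (measurable_fun D (fun x => z * x))
    | |- measurable_fun _ (fun x => - _) => apply: measurable_funN
    | |- measurable_fun _ (fun x => _ * _) => apply: measurable_funM
    | |- measurable_fun _ (fun x => _ ^+ _) => apply: measurable_funX
    | |- measurable_fun _ (fun x => `|_|) => apply: (measurableT_comp (@normr_measurable _ _))
    | |- measurable_fun _ (fun x => expR _) => apply: (measurableT_comp (@measurable_expR _))
    | |- measurable_fun _ (fun x => cos _) => apply: (measurableT_comp (@measurable_cos _))
    | |- measurable_fun _ (fun x => sin _) => apply: (measurableT_comp (@measurable_sin _))
    | |- measurable_fun _ (fun x => (_, _)) => apply: measurable_fun_pair
    | |- measurable_fun _ (fun x => fst _) => apply: (measurableT_comp measurable_fst)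
    | |- measurable_fun _ (fun x => snd _) => apply: (measurableT_comp measurable_snd)
    | H : measurable_fun setT ?f |- measurable_fun _ (fun x => ?f _) =>
        apply: (measurableT_comp H)
    | H : forall n, measurable_fun setT (?f n) |- measurable_fun _ (fun x => ?f ?n _) =>
        apply: (measurableT_comp (H n))
    end ].

Ltac nneg := intros; repeat first
  [ by [] | exact: sqr_ge0 | exact: expR_ge0 | exact: normr_ge0
  | match goal with
    | |- is_true (0 <= _ + _) => apply: addr_ge0
    | |- is_true (0 <= _ * _) => apply: mulr_ge0
    | |- is_true (0 <= _^-1) => rewrite invr_ge0
    end
  | (apply: ltW; assumption) ].

Section ge0_real_integral.
Context d (T : measurableType d) (R : realType).
Variable m : {measure set T -> \bar R}.
Implicit Types f g : T -> R.

Lemma ge0_intD f g : measurable_fun setT f -> measurable_fun setT g ->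
  (forall x, 0 <= f x) -> (forall x, 0 <= g x) ->
  (\int[m]_x (f x + g x)%:E = \int[m]_x (f x)%:E + \int[m]_x (g x)%:E)%E.
Proof.
move=> mf mg f0 g0; under eq_integral do rewrite EFinD.
by rewrite ge0_integralD//; meas; move=> x _; rewrite lee_fin.
Qed.

Lemma ge0_intZ (k : R) f : measurable_fun setT f -> 0 <= k ->
  (forall x, 0 <= f x) -> (\int[m]_x (k * f x)%:E = k%:E * \int[m]_x (f x)%:E)%E.
Proof.
move=> mf k0 f0; under eq_integral do rewrite EFinM.
by rewrite ge0_integralZl_EFin//; meas; move=> x _; rewrite lee_fin.
Qed.

Lemma ge0_int_le f g : measurable_fun setT f -> measurable_fun setT g ->
  (forall x, 0 <= f x) -> (forall x, f x <= g x) ->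
  (\int[m]_x (f x)%:E <= \int[m]_x (g x)%:E)%E.
Proof.
move=> mf mg f0 fg; apply: ge0_le_integral => //; meas.
  by move=> x _; rewrite lee_fin.
by move=> x _; rewrite lee_fin.
Qed.

Lemma eq_int f g : f =1 g -> (\int[m]_x (f x)%:E = \int[m]_x (g x)%:E)%E.
Proof. by move=> fg; apply: eq_integral => x _; rewrite fg. Qed.

Lemma ge0_int f : (forall x, 0 <= f x) -> (0 <= \int[m]_x (f x)%:E)%E.
Proof. by move=> f0; apply: integral_ge0 => x _; rewrite lee_fin. Qed.

Lemma ge0_int_fin f : (forall x, 0 <= f x) -> (\int[m]_x (f x)%:E < +oo)%E ->
  (\int[m]_x (f x)%:E)%E = (\int[m]_x f x)%:E.
Proof.
by move=> f0 fi; rewrite /Rintegral fineK// ge0_fin_numE//; exact: ge0_int.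
Qed.

Lemma ge0_integrable f : measurable_fun setT f -> (forall x, 0 <= f x) ->
  (\int[m]_x (f x)%:E < +oo)%E -> m.-integrable setT (EFin \o f).
Proof.
move=> mf f0 fi; apply/integrableP; split; meas.
by under eq_integral do rewrite /= ger0_norm//.
Qed.

Lemma integrable_dom f g : measurable_fun setT f -> (forall x, `|f x| <= g x) ->
  m.-integrable setT (EFin \o g) -> m.-integrable setT (EFin \o f).
Proof.
move=> mf fg; apply: le_integrable => //; meas.
by move=> x _; rewrite lee_fin (le_trans (fg x))// ler_norm.
Qed.

Lemma integrable_mfun f : m.-integrable setT (EFin \o f) -> measurable_fun setT f.
Proof. by move=> /integrableP[/measurable_EFinP]. Qed.

End ge0_real_integral.

(** * Invariance of Lebesgue measure and integrals depending on a parameter *)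

Section lebesgue_invariance.
Variable R : realType.
Local Notation mu := (@lebesgue_measure R).

(** Lebesgue measure is determined by its values on half-open intervals, and translating an interval
    keeps its length. *)
Lemma lebesgue_measure_shift (c : R) (A : set R) : measurable A ->
  pushforward mu ((fun x => x + c) : _ -> measurableTypeR R) A = mu A.
Proof.
have mc : measurable_fun setT ((fun x => x + c) : R -> measurableTypeR R) by meas.
move=> mA; apply/esym/lebesgue_measure_unique => //= _ [[a b]] _ <-.
rewrite /pushforward.
rewrite (_ : _ @^-1` _ = `](a - c), (b - c)]%classic); last first.
  by apply/seteqP; split => x /=; rewrite !in_itv/= ltrBlDr lerBrDr.
rewrite !lebesgue_measure_itv/= !lte_fin ltrD2r.
by case: ifP => // _; rewrite -!EFinD; congr EFin; ring.
Qed.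

Lemma ge0_integral_shift (f : R -> \bar R) c : measurable_fun setT f ->
  (forall x, 0 <= f x)%E -> (\int[mu]_x f (x + c)%R = \int[mu]_x f x)%E.
Proof.
move=> mf f0.
have mc : measurable_fun setT ((fun x => x + c) : R -> measurableTypeR R) by meas.
have := @ge0_integral_pushforward _ _ (measurableTypeR R) (measurableTypeR R) R _ mc mu setT f measurableT mf (fun y _ => f0 y).
rewrite preimage_setT => <-.
by apply: eq_measure_integral => A mA _; exact: lebesgue_measure_shift.
Qed.

Lemma ge0_integral_opp (f : R -> \bar R) : measurable_fun setT f ->
  (forall x, 0 <= f x)%E -> (\int[mu]_x f (- x)%R = \int[mu]_x f x)%E.
Proof.
move=> mf f0.
have mc : measurable_fun setT ((fun x => - x) : R -> measurableTypeR R) by meas.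
have := @ge0_integral_pushforward _ _ (measurableTypeR R) (measurableTypeR R) R _ mc mu setT f measurableT mf (fun y _ => f0 y).
rewrite preimage_setT => <-.
by apply: eq_measure_integral => A mA _; exact: lebesgue_measureN.
Qed.

Lemma ge0_int_shift (f : R -> R) c : measurable_fun setT f ->
  (forall x, 0 <= f x) -> (\int[mu]_x (f (x + c)%R)%:E = \int[mu]_x (f x)%:E)%E.
Proof.
by move=> mf f0; rewrite -(@ge0_integral_shift (EFin \o f) c)//; meas.
Qed.

Lemma ge0_int_opp (f : R -> R) : measurable_fun setT f ->
  (forall x, 0 <= f x) -> (\int[mu]_x (f (- x)%R)%:E = \int[mu]_x (f x)%:E)%E.
Proof.
by move=> mf f0; rewrite -(@ge0_integral_opp (EFin \o f))//; meas.
Qed.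

Lemma Rintegral_shift (f : R -> R) c : mu.-integrable setT (EFin \o f) ->
  \int[mu]_x f (x + c) = \int[mu]_x f x.
Proof.
move=> /integrable_mfun mf; rewrite /Rintegral.
rewrite [in LHS]integralE [in RHS]integralE; congr (fine (_ - _)).
- have mf' : measurable_fun setT (EFin \o f)^\+%E.
    by apply: measurable_funepos; meas.
  rewrite -[RHS](ge0_integral_shift c mf' (funepos_ge0 _)).
  by apply: eq_integral => x _; rewrite !funeposE.
- have mf' : measurable_fun setT (EFin \o f)^\-%E.
    by apply: measurable_funeneg; meas.
  rewrite -[RHS](ge0_integral_shift c mf' (funeneg_ge0 _)).
  by apply: eq_integral => x _; rewrite !funenegE.
Qed.

Lemma integrable_shift (f : R -> R) c : mu.-integrable setT (EFin \o f) ->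
  mu.-integrable setT (EFin \o (fun x => f (x + c))).
Proof.
move=> fi; have mf := integrable_mfun fi.
move: fi => /integrableP[_]; rewrite -(ge0_integral_shift c)//=; last by meas.
by move=> fi; apply/integrableP; split => //=; meas.
Qed.

(** Tonelli's theorem gives measurability for the positive and the negative part separately. Where
    the integral is infinite or undefined, [fine] supplies a default value and is itself measurable,
    so measurability of [F] suffices. *)
Lemma measurable_Rintegral_param d (T : measurableType d) (F : T * R -> R) :
  measurable_fun setT F -> measurable_fun setT (fun x => \int[mu]_y F (x, y)).
Proof.
move=> mF; apply: (measurableT_comp (@fine_measurable _ _ measurableT)) => //.
under eq_fun do rewrite integralE.
apply: emeasurable_funB.
- have mF' : measurable_fun setT (EFin \o F)^\+%E.
    by apply: measurable_funepos; meas.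
  have := measurable_fun_fubini_tonelli_F (m2 := mu) _ mF' (funepos_ge0 _).
  apply: eq_measurable_fun => x _.
  by apply: eq_integral => y _; rewrite !funeposE.
- have mF' : measurable_fun setT (EFin \o F)^\-%E.
    by apply: measurable_funeneg; meas.
  have := measurable_fun_fubini_tonelli_F (m2 := mu) _ mF' (funeneg_ge0 _).
  apply: eq_measurable_fun => x _.
  by apply: eq_integral => y _; rewrite !funenegE.
Qed.

Lemma measurable_int_param d (T : measurableType d) (F : T * R -> R) :
  measurable_fun setT F -> (forall z, 0 <= F z) ->
  measurable_fun setT (fun x => \int[mu]_y (F (x, y))%:E)%E.
Proof.
move=> mF F0; apply: (@measurable_fun_fubini_tonelli_F _ _ _ _ _ mu (EFin \o F)) => //.
by meas.
Qed.

Lemma ge0_int_swap (F : R -> R -> R) : measurable_fun setT (fun z : R * R => F z.1 z.2) ->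
  (forall x y, 0 <= F x y) ->
  (\int[mu]_x \int[mu]_y (F x y)%:E = \int[mu]_y \int[mu]_x (F x y)%:E)%E.
Proof.
move=> mF F0; apply: (@fubini_tonelli _ _ _ _ _ mu mu (fun z : R * R => (F z.1 z.2)%:E)).
- by meas.
- by move=> z; rewrite lee_fin.
Qed.

Lemma ge0_int_prod (F : R -> R -> R) : measurable_fun setT (fun z : R * R => F z.1 z.2) ->
  (forall x y, 0 <= F x y) ->
  (\int[(mu \x mu)%E]_z (F z.1 z.2)%:E = \int[mu]_x \int[mu]_y (F x y)%:E)%E.
Proof.
move=> mF F0; apply: (@fubini_tonelli1 _ _ _ _ _ mu mu (fun z : R * R => (F z.1 z.2)%:E)).
- by meas.
- by move=> z; rewrite lee_fin.
Qed.

End lebesgue_invariance.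

(** * The Poisson kernel *)

Section poisson_kernel.
Variable R : realType.
Local Notation mu := (@lebesgue_measure R).
Implicit Types e l z u : R.
Lemma cvg_mulry (k : R) : 0 < k -> (k * x) @[x --> +oo] --> +oo.
Proof.
move=> k0; apply/cvgryPge => A.
near=> x; rewrite mulrC -ler_pdivrMr//; near: x.
Unshelve. all: by end_near. Qed.

Lemma continuous_exp_cos e z : continuous (fun u => expR (- (e * `|u|)) * (1 + cos (z * u))).
Proof.
move=> u; apply: cvgM.
  apply: (@continuous_comp _ _ _ (fun u => - (e * `|u|)) expR); last exact: continuous_expR.
  apply: cvgN; apply: cvgM; first exact: cvg_cst.
  exact: cvg_norm.
apply: cvgD; first exact: cvg_cst.
apply: (@continuous_comp _ _ _ (fun u => z * u) cos); last exact: continuous_cos.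
apply: cvgM; [exact: cvg_cst|exact: cvg_id].
Qed.

(** An antiderivative of [expR (- (e * u)) * (1 + cos (z * u))]. It vanishes at infinity, so minus
    its value at 0 is the integral over the half line. *)
Let F e z u := - expR (- (e * u)) / e + expR (- (e * u)) * (z * sin (z * u) - e * cos (z * u)) / (e ^+ 2 + z ^+ 2).

Let F_derive e z u : 0 < e -> is_derive u 1 (F e z) (expR (- (e * u)) * (1 + cos (z * u))).
Proof.
move=> e0; rewrite /F.
have ez : e ^+ 2 + z ^+ 2 != 0 by rewrite gt_eqF// ltr_pwDl ?exprn_gt0 ?sqr_ge0.
apply: is_derive_eq.
rewrite /GRing.scale /=.
field.
by rewrite ez gt_eqF.
Qed.

Let F_cvgy e z : 0 < e -> F e z u @[u --> +oo] --> 0.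
Proof.
move=> e0.
have ez : 0 < e ^+ 2 + z ^+ 2 by rewrite ltr_pwDl ?exprn_gt0 ?sqr_ge0.
apply: norm_cvg0.
apply: (@squeeze_cvgr _ _ _ _ (cst 0) (fun u => expR (- (e * u)) * (e^-1 + (`|z| + e) / (e ^+ 2 + z ^+ 2)))).
- near=> u; rewrite normr_ge0/= /F.
  rewrite (_ : - expR _ / e + _ = expR (- (e * u)) *
    ((z * sin (z * u) - e * cos (z * u)) / (e ^+ 2 + z ^+ 2) - e^-1)); last first.
    by field; rewrite !gt_eqF.
  rewrite normrM (gtr0_norm (expR_gt0 _)) ler_pM2l ?expR_gt0//.
  rewrite (le_trans (ler_normB _ _))// addrC lerD//.
    by rewrite gtr0_norm// invr_gt0.
  rewrite normrM normfV (gtr0_norm ez) ler_pM2r ?invr_gt0//.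
  rewrite (le_trans (ler_normB _ _))// !normrM (gtr0_norm e0).
  apply: lerD.
  - by rewrite ler_piMr// ler_norml sin_geN1 sin_le1.
  - by rewrite ler_piMr ?(ltW e0)// ler_norml cos_geN1 cos_le1.
- exact: cvg_cst.
- rewrite -(mul0r (e^-1 + (`|z| + e) / (e ^+ 2 + z ^+ 2))).
  apply: cvgM; last exact: cvg_cst.
  exact: (cvg_comp _ _ (cvg_mulry e0) (@cvgr_expR R)).
Unshelve. all: by end_near. Qed.

(** The integrand is even, so this is twice the half-line integral. Using [1 + cos] in place of
    [cos] keeps it nonnegative, at the price of the extra term [2 / e]; the other term is the
    Poisson kernel. *)
Lemma int_exp_cos e z : 0 < e ->
  (\int[mu]_u (expR (- (e * `|u|)) * (1 + cos (z * u)))%:E =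
  (2 / e + 2 * e / (e ^+ 2 + z ^+ 2))%:E)%E.
Proof.
move=> e0.
have ez : e ^+ 2 + z ^+ 2 != 0 by rewrite gt_eqF// ltr_pwDl ?exprn_gt0 ?sqr_ge0.
have f0 u : 0 <= expR (- (e * `|u|)) * (1 + cos (z * u)).
  by rewrite mulr_ge0 ?expR_ge0// -lerBlDl sub0r cos_geN1.
rewrite ge0_symfun_integralT//; first last.
- by move=> u /=; rewrite normrN mulrN cosN.
- exact: continuous_exp_cos.
rewrite (_ : [set x | _] = `[0, +oo[%classic); last first.
  by apply/seteqP; split => x/=; rewrite in_itv/= andbT.
rewrite (@ge0_continuous_FTC2y _ _ (F e z) 0 0).
- rewrite /F !(mulr0, oppr0, expR0, sin0, cos0) -EFinB -EFinM; congr EFin.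
  field. by rewrite ez gt_eqF.
- by move=> u _; exact: f0.
- by apply: continuous_in_subspaceT => u _; exact: continuous_exp_cos.
- exact: F_cvgy.
- by move=> u _; have := F_derive z u e0; case.
- apply: cvg_at_right_filter.
  apply: differentiable_continuous; apply/derivable1_diffP.
  by have := F_derive z 0 e0; case.
- move=> u; rewrite in_itv/= andbT => u0.
  by rewrite derive1E; have [_ ->] := F_derive z u e0; rewrite gtr0_norm.
Qed.

(** An arctangent is an antiderivative. The mass does not depend on [e], which is what makes the
    kernel an approximate identity as [e] tends to 0. *)
Lemma int_poisson e l : 0 < e -> l != 0 ->
  (\int[mu]_z (2 * e / (e ^+ 2 + (l * z) ^+ 2))%:E = (2 * pi / `|l|)%:E)%E.
Proof.
move=> e0 l0.
have ez z : 0 < e ^+ 2 + (l * z) ^+ 2 by rewrite ltr_pwDl ?exprn_gt0 ?sqr_ge0.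
have f0 z : 0 <= 2 * e / (e ^+ 2 + (l * z) ^+ 2).
  by rewrite divr_ge0 ?mulr_ge0 ?ltW.
have cf : continuous (fun z => 2 * e / (e ^+ 2 + (l * z) ^+ 2)).
  move=> z; apply: cvgM; first exact: cvg_cst.
  apply: cvgV; first by rewrite gt_eqF.
  apply: cvgD; first exact: cvg_cst.
  have h : l * x @[x --> z] --> l * z by apply: cvgM; [exact: cvg_cst|exact: cvg_id].
  exact: (cvgM h h).
rewrite ge0_symfun_integralT//; last first.
  by move=> z /=; rewrite mulrN sqrrN.
rewrite (_ : [set x | _] = `[0, +oo[%classic); last first.
  by apply/seteqP; split => x/=; rewrite in_itv/= andbT.
have l'0 : 0 < `|l| by rewrite normr_gt0.
have l2 z : (l * z) ^+ 2 = (`|l| * z) ^+ 2 by rewrite !exprMn real_normK// num_real.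
have dG z : is_derive z 1 (fun z => 2 / `|l| * atan (`|l| / e * z)) (2 * e / (e ^+ 2 + (l * z) ^+ 2)).
  apply: is_derive_eq.
  rewrite /GRing.scale /= l2; field.
  by rewrite -l2 !gt_eqF.
rewrite (@ge0_continuous_FTC2y _ _ (fun z => 2 / `|l| * atan (`|l| / e * z)) 0 (2 / `|l| * (pi / 2))).
- rewrite mulr0 atan0 mulr0 sube0 -EFinM; congr EFin.
  by field; rewrite gt_eqF.
- by move=> u _; exact: f0.
- by apply: continuous_in_subspaceT => u _; exact: cf.
- apply: cvgM; first exact: cvg_cst.
  apply: (@cvg_comp _ _ _ (fun z => `|l| / e * z) atan _ +oo); last exact: cvgy_atan.
  by apply: cvg_mulry; rewrite divr_gt0.
- by move=> u _; have := dG u; case.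
- apply: cvg_at_right_filter.
  apply: cvgM; first exact: cvg_cst.
  apply: (@continuous_comp _ _ _ (fun z => `|l| / e * z) atan); last exact: continuous_atan.
  by apply: cvgM; [exact: cvg_cst|exact: cvg_id].
- by move=> u; rewrite derive1E; have [_ ->] := dG u.
Qed.
End poisson_kernel.

(** * Continuity of translations in L2 *)

Section translation_continuity.
Variable R : realType.
Local Notation mu := (@lebesgue_measure R).

Lemma cvge0_le (u : nat -> \bar R) (e : R) : u @ \oo --> 0%E -> 0 < e ->
  exists n, (u n <= e%:E)%E.
Proof.
move=> /fine_cvgP[ufin /cvgr0Pnorm_lt cu] e0.
have [n [un1 un2]] := filter_ex (filterI ufin (cu _ e0)).
by exists n; rewrite -(fineK un1) lee_fin (le_trans (ler_norm _))// ltW.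
Qed.

(** Uniform continuity on a segment: the estimate holds near each point [(x, 0)], and compactness in
    its covering form yields one neighbourhood of 0 valid for all [x]. *)
Lemma continuous_shift_near (g : R -> R) (n e : R) : continuous g -> 0 < e ->
  \forall z \near (0 : R), forall x, `|x| <= n -> `|g (x + z) - g x| < e.
Proof.
move=> cg e0.
have /compact_near_coveringP/(_ R (nbhs (0 : R)) (fun z x => `|g (x + z) - g x| < e)) := @segment_compact R (- n) n.
move=> H.
have : \forall z \near (0 : R), `[(- n), n] `<=` (fun x => `|g (x + z) - g x| < e).
  apply: H => /= x0 _; pose x : R := x0; rewrite -/x.
  have c1 : g (w.1 + w.2) - g w.1 @[w --> (x, (0 : R))] --> (0 : R).
    rewrite -[X in _ --> X](subrr (g x)); apply: cvgB.
      rewrite -[X in _ --> g X]addr0.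
      apply: (@cvg_comp _ _ _ (fun w : R * R => w.1 + w.2) g _ (nbhs (x + 0))); last exact: cg.
      by apply: cvgD; [exact: cvg_fst|exact: cvg_snd].
    apply: (@cvg_comp _ _ _ (fun w : R * R => w.1) g _ (nbhs x)); last exact: cg.
    exact: cvg_fst.
  move/cvgr0Pnorm_lt : c1 => /(_ _ e0).
  by [].
apply: filterS => z hz x xn; apply: hz => /=.
by rewrite in_itv/= -ler_norml.
Unshelve. all: by end_near. Qed.

Local Notation seg n := (`[(- n), n]%classic).

Let seg1 (n x : R) : `|x| <= n -> \1_(seg n) x = 1 :> R.
Proof. by move=> xn; rewrite indicE mem_set//= in_itv/= -ler_norml. Qed.

(** Since [|p| <= M], the squared increment is at most [2 * M] times its modulus, so an
    approximation of [p] in L1 by a continuous function is enough. *)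
Lemma L2_shift_cvg_bounded (p : R -> R) (n M : R) : measurable_fun setT p ->
  0 < n -> 0 < M ->
  (forall x, `|p x| <= M) -> (forall x, n < `|x| -> p x = 0) ->
  forall e, 0 < e -> exists2 dl : R, 0 < dl & forall z, `|z| < dl ->
   (\int[mu]_x ((p (x + z)%R - p x) ^+ 2)%:E <= e%:E)%E.
Proof.
move=> mp n0 M0 pM pn e e0.
have mE : measurable (seg (n + 2)) by exact: measurable_itv.
have muE : (mu (seg (n + 2)) < +oo)%E.
  by rewrite lebesgue_measure_itv; case: ifP => _; rewrite -?EFinD ltry.
have ip : mu.-integrable (seg (n + 2)) (EFin \o p).
  apply: measurable_bounded_integrable => //.
    exact: measurable_funTS.
  exists M; split; first exact: num_real.
  by move=> x Mx y _ /=; rewrite (le_trans (pM y))// ltW.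
have [g_ [cg_ ig_ cv]] := approximation_continuous_integrable mE muE ip.
(* The final bound is [2 * M * (e1 + e1 + e2 * (2 * (n + 1)))]. The values of [e1] and of [e2] below
   make each of its two parts equal to [e / 2]. *)
pose e1 := e / (8 * M).
have e10 : 0 < e1 by rewrite divr_gt0// mulr_gt0.
have [k hk] : exists k, (\int[mu]_(z in seg (n + 2)) `|(p z - g_ k z)%:E| <= e1%:E)%E.
  exact: cvge0_le cv e10.
pose g := g_ k.
have mg : measurable_fun setT g by apply: continuous_measurable_fun; exact: cg_.
pose G x := `|p x - g x| * \1_(seg (n + 2)) x.
have mG : measurable_fun setT G.
  by apply: measurable_funM; [meas|exact: measurable_indic].
have G0 x : 0 <= G x by rewrite mulr_ge0.
have iG : (\int[mu]_x (G x)%:E <= e1%:E)%E.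
  apply: le_trans hk; rewrite [leRHS]integral_mkcond.
  rewrite le_eqVlt; apply/orP; left; apply/eqP.
  apply: eq_integral => x _; rewrite patchE /G indicE.
  by case: ifP => xE; rewrite ?mulr1 ?mulr0.
pose e2 := e / (4 * M * (2 * (n + 1))).
have e20 : 0 < e2 by rewrite divr_gt0// !mulr_gt0// addr_gt0.
have /nbhs_ballP[dl /= dl0 hdl] := @continuous_shift_near g (n + 1) e2 (cg_ k) e20.
(* With [|z| < 1] the increment of [p] vanishes when [|x| > n + 1]. Otherwise [x] and [x + z] both
   lie in the segment of radius [n + 2], where [g] approximates [p]. *)
exists (Num.min dl 1); first by rewrite lt_min dl0 ltr01.
move=> z; rewrite lt_min => /andP[zdl z1].
have {hdl zdl}hz x : `|x| <= n + 1 -> `|g (x + z) - g x| < e2.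
  by apply: hdl; rewrite /ball/= sub0r normrN.
pose H x := 2 * M * (G (x + z) + G x + e2 * \1_(seg (n + 1)) x).
have mH1 : measurable_fun setT (\1_(seg (n + 1)) : R -> R).
  by apply: measurable_indic; exact: measurable_itv.
have le1 x : `|p (x + z) - p x| <= G (x + z) + G x + e2 * \1_(seg (n + 1)) x.
  have [xn|xn] := leP `|x| (n + 1); last first.
    rewrite !pn ?subrr ?normr0.
    - by rewrite !addr_ge0// mulr_ge0// ltW.
    - lra.
    - by have := ler_normB (x + z) z; rewrite addrK; lra.
  have xz : `|x + z| <= n + 2 by have := ler_normD x z; lra.
  have xn2 : `|x| <= n + 2 by lra.
  rewrite /G !seg1// !mulr1.
  rewrite (_ : p (x + z) - p x = (p (x + z) - g (x + z)) - (p x - g x) + (g (x + z) - g x)); last ring.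
  rewrite (le_trans (ler_normD _ _))// lerD//; last exact/ltW/hz.
  exact: ler_normB.
have le2 x : (p (x + z) - p x) ^+ 2 <= H x.
  rewrite -real_normK ?num_real// expr2 /H.
  apply: ler_pM => //.
  have := ler_normB (p (x + z)) (p x).
  by have := pM x; have := pM (x + z); lra.
apply: (@le_trans _ _ (\int[mu]_x (H x)%:E)%E).
  apply: ge0_int_le => //.
  - meas.
  - rewrite /H; meas.
  - by move=> x; exact: sqr_ge0.
have i1 : (\int[mu]_x (\1_(seg (n + 1)) x)%:E = (2 * (n + 1))%:E)%E.
  rewrite integral_indic// setIT; transitivity (mu (seg (n + 1))) => //.
  rewrite lebesgue_measure_itv /= lte_fin.
  rewrite ifT; last lra.
  by rewrite -EFinB; congr EFin; ring.
have mGz : measurable_fun setT (fun x : R => G (x + z)) by meas.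
rewrite ge0_intZ; last 3 first.
- meas.
- by rewrite mulr_ge0// ltW.
- by move=> x; rewrite !addr_ge0// mulr_ge0// ltW.
rewrite ge0_intD; last 4 first.
- meas.
- meas.
- by move=> x; rewrite addr_ge0.
- by move=> x; rewrite mulr_ge0// ltW.
rewrite ge0_intD// ge0_int_shift// ge0_intZ//; last exact: ltW.
rewrite i1.
apply: (@le_trans _ _ ((2 * M)%:E * (e1%:E + e1%:E + e2%:E * (2 * (n + 1))%:E))%E).
  rewrite lee_pmul2l// ?lte_fin ?mulr_gt0//.
  by rewrite leeD2r// leeD.
rewrite -[leLHS]/((2 * M * (e1 + e1 + e2 * (2 * (n + 1))))%:E) lee_fin le_eqVlt; apply/orP; left; apply/eqP.
rewrite /e1 /e2; field.
by rewrite !gt_eqF// addr_gt0.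
Unshelve. all: by end_near. Qed.

(** Truncating both the argument and the values of [p] gives an L2 approximation by dominated
    convergence. The increment of [p] is then the increment of the truncation plus two errors of
    equal norm, and the square of a sum of three terms is at most three times the sum of the
    squares, hence [e / 9]. *)
Lemma L2_shift_cvg (p : R -> R) : measurable_fun setT p ->
  (\int[mu]_x (p x ^+ 2)%:E < +oo)%E ->
  forall e, 0 < e -> exists2 dl : R, 0 < dl & forall z, `|z| < dl ->
   (\int[mu]_x ((p (x + z)%R - p x) ^+ 2)%:E <= e%:E)%E.
Proof.
move=> mp pi e e0.
pose A (n : nat) := [set x | `|x| <= n.+1%:R] `&` [set x | `|p x| <= n.+1%:R].
have mA n : measurable (A n).
  apply: measurableI.
  - rewrite -[X in measurable X]setTI; apply: measurable_fun_le => //; meas.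
  - rewrite -[X in measurable X]setTI; apply: measurable_fun_le => //; meas.
pose q n x := p x * \1_(A n) x.
have mq n : measurable_fun setT (q n).
  by apply: measurable_funM; [meas|exact: measurable_indic].
have [n hn] : exists n, (\int[mu]_x ((p x - q n x) ^+ 2)%:E <= (e / 9)%:E)%E.
  have [//|||||_ _] := @dominated_convergence _ _ R mu setT measurableT
    (fun n x => ((p x - q n x) ^+ 2)%:E) (cst 0)%E (fun x => (p x ^+ 2)%:E).
  - by move=> n; have mqn := mq n; meas.
  - exact: measurable_cst.
  - apply/aeW => x _; apply: cvg_near_cst.
    near=> n; have xA : A n x; last by rewrite /q indicE mem_set// mulr1 subrr expr0n.
    split => /=.
    - by apply: (@le_trans _ _ n%:R); [near: n; exact: nbhs_infty_ger|rewrite ler_nat].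
    - by apply: (@le_trans _ _ n%:R); [near: n; exact: nbhs_infty_ger|rewrite ler_nat].
  - apply: ge0_integrable => //; meas. by move=> x; exact: sqr_ge0.
  - apply/aeW => x n _. rewrite gee0_abs ?lee_fin ?sqr_ge0//.
    by rewrite /q indicE; case: (x \in _); rewrite ?mulr1 ?mulr0 ?subr0// subrr expr0n sqr_ge0.
  rewrite integral_cst// mul0e => cv.
  by apply: (cvge0_le cv); rewrite divr_gt0.
have [|||||dl dl0 hdl] := @L2_shift_cvg_bounded (q n) n.+1%:R n.+1%:R (mq n) _ _ _ _ (e / 9).
- by rewrite ltr0n.
- by rewrite ltr0n.
- move=> x; rewrite /q indicE; case: (boolP (x \in A n)) => /=.
    by rewrite inE => -[_ /=]; rewrite mulr1.
  by rewrite mulr0 normr0.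
- move=> x xn; rewrite /q indicE memNset ?mulr0// => -[/= h _].
  by move: xn; rewrite ltNge h.
- by rewrite divr_gt0.
exists dl => // z /hdl hz.
pose r x := (p x - q n x) ^+ 2.
have mr : measurable_fun setT r by rewrite /r; meas.
have r0 x : 0 <= r x by exact: sqr_ge0.
have mqn := mq n.
apply: (@le_trans _ _ (\int[mu]_x (3 * (r (x + z) + (q n (x + z) - q n x) ^+ 2 + r x))%:E)%E).
  apply: ge0_int_le.
  - meas.
  - meas.
  - by move=> x; exact: sqr_ge0.
  - move=> x; rewrite /r.
    set a := p (x + z); set b := q n (x + z); set c := q n x; set f := p x.
    rewrite -subr_ge0 (_ : _ - _ = ((a - b) - (b - c)) ^+ 2 + ((a - b) + (f - c)) ^+ 2 + ((b - c) + (f - c)) ^+ 2); last ring.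
    by rewrite !addr_ge0// sqr_ge0.
rewrite ge0_intZ//; last 2 first.
- meas.
- by move=> x; rewrite !addr_ge0// sqr_ge0.
rewrite ge0_intD; [|by meas|by meas|by nneg|by nneg].
rewrite ge0_intD; [|by meas|by meas|by nneg|by nneg].
rewrite ge0_int_shift//.
apply: (@le_trans _ _ (3%:E * ((e / 9)%:E + (e / 9)%:E + (e / 9)%:E))%E).
  by rewrite lee_pmul2l// leeD// leeD.
by rewrite -!EFinD -EFinM lee_fin; lra.
Unshelve. all: by end_near. Qed.
End translation_continuity.

(** * Plancherel for real functions *)

Section integrable_lemmas.
Context d (T : measurableType d) (R : realType).
Variable m : {measure set T -> \bar R}.
Implicit Types f g : T -> R.

Lemma integrable_int f : m.-integrable setT (EFin \o f) ->
  (\int[m]_x (f x)%:E)%E = (\int[m]_x f x)%:E.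
Proof. by move=> fi; rewrite /Rintegral fineK//; exact: integrable_fin_num. Qed.

Lemma integrable_mul_bounded f g : m.-integrable setT (EFin \o f) ->
  measurable_fun setT g -> (forall x, `|g x| <= 1) ->
  m.-integrable setT (EFin \o (fun x => f x * g x)).
Proof.
move=> fi mg g1; have mf := integrable_mfun fi.
apply: (@integrable_dom _ _ _ _ _ (fun x => `|f x|)).
- by meas.
- by move=> x; rewrite normrM ler_piMr.
- exact: integrable_norm fi.
Qed.

Lemma integrable_scale (k : R) f : m.-integrable setT (EFin \o f) ->
  m.-integrable setT (EFin \o (fun x => k * f x)).
Proof. by move=> fi; exact: (integrableZl measurableT k fi). Qed.

Lemma integrable_add f g : m.-integrable setT (EFin \o f) ->
  m.-integrable setT (EFin \o g) -> m.-integrable setT (EFin \o (fun x => f x + g x)).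
Proof. by move=> fi gi; exact: (integrableD measurableT fi gi). Qed.

Lemma Rintegral_lin2 (a b : R) f g : m.-integrable setT (EFin \o f) ->
  m.-integrable setT (EFin \o g) ->
  \int[m]_x (a * f x + b * g x) = a * \int[m]_x f x + b * \int[m]_x g x.
Proof.
by move=> fi gi; rewrite RintegralD ?RintegralZl//; exact: integrable_scale.
Qed.

Lemma integrable_lin2 (a b : R) f g : m.-integrable setT (EFin \o f) ->
  m.-integrable setT (EFin \o g) ->
  m.-integrable setT (EFin \o (fun x => a * f x + b * g x)).
Proof. by move=> fi gi; apply: integrable_add; exact: integrable_scale. Qed.

End integrable_lemmas.

Lemma EFin_addI (R : realType) (a : R) (x y : \bar R) :
  (a%:E + x = a%:E + y)%E -> x = y.
Proof. by case: x y => [x||] [y||] //= [] /addrI ->. Qed.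

Lemma norm_cos_le1 (R : realType) (x : R) : `|cos x| <= 1.
Proof. by rewrite ler_norml cos_geN1 cos_le1. Qed.

Lemma norm_sin_le1 (R : realType) (x : R) : `|sin x| <= 1.
Proof. by rewrite ler_norml sin_geN1 sin_le1. Qed.

Section real_plancherel.
Variable R : realType.
Local Notation mu := (@lebesgue_measure R).
Local Notation L1 p := (mu.-integrable setT (EFin \o p)).
Variable l : R.
Implicit Types p q : R -> R.

Definition cosT p (u : R) : R := \int[mu]_x (p x * cos (l * u * x)).
Definition sinT p (u : R) : R := \int[mu]_x (p x * sin (l * u * x)).
(** The squared modulus of the Fourier transform of the real function [p] at the frequency
    [l * u]. *)
Definition power p u := cosT p u ^+ 2 + sinT p u ^+ 2.

Lemma integrable_cosT p u : L1 p -> L1 (fun x => p x * cos (l * u * x)).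
Proof. by move=> pi; apply: integrable_mul_bounded => // [|x]; [meas|exact: norm_cos_le1]. Qed.

Lemma integrable_sinT p u : L1 p -> L1 (fun x => p x * sin (l * u * x)).
Proof. by move=> pi; apply: integrable_mul_bounded => // [|x]; [meas|exact: norm_sin_le1]. Qed.

Lemma measurable_cosT p : measurable_fun setT p -> measurable_fun setT (cosT p).
Proof.
move=> mp; apply: (@measurable_Rintegral_param _ _ _ (fun z : R * R => p z.2 * cos (l * z.1 * z.2))).
by meas.
Qed.

Lemma measurable_sinT p : measurable_fun setT p -> measurable_fun setT (sinT p).
Proof.
move=> mp; apply: (@measurable_Rintegral_param _ _ _ (fun z : R * R => p z.2 * sin (l * z.1 * z.2))).
by meas.
Qed.

Lemma measurable_power p : measurable_fun setT p -> measurable_fun setT (power p).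
Proof.
move=> mp; have mc := measurable_cosT mp; have ms := measurable_sinT mp.
by rewrite /power; meas.
Qed.

Lemma power_ge0 p u : 0 <= power p u.
Proof. by rewrite addr_ge0// sqr_ge0. Qed.

Lemma cosT_lin a b p q u : L1 p -> L1 q ->
  cosT (fun x => a * p x + b * q x) u = a * cosT p u + b * cosT q u.
Proof.
move=> pi qi; rewrite -Rintegral_lin2; [|exact: integrable_cosT..].
by apply: eq_Rintegral => x _; ring.
Qed.

Lemma sinT_lin a b p q u : L1 p -> L1 q ->
  sinT (fun x => a * p x + b * q x) u = a * sinT p u + b * sinT q u.
Proof.
move=> pi qi; rewrite -Rintegral_lin2; [|exact: integrable_sinT..].
by apply: eq_Rintegral => x _; ring.
Qed.

Lemma integrable_trig p u (a b c : R) : L1 p ->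
  L1 (fun x => p x * (a + cos (l * u * x) * b + sin (l * u * x) * c)).
Proof.
move=> pi.
rewrite (_ : (fun x => _) = (fun x => 1 * (a * p x + b * (p x * cos (l * u * x))) + c * (p x * sin (l * u * x)))).
  apply: integrable_lin2; last exact: integrable_sinT.
  by apply: integrable_lin2 => //; exact: integrable_cosT.
by apply/funext => x; ring.
Qed.

Lemma Rintegral_trig p u (a b c : R) : L1 p ->
  \int[mu]_x (p x * (a + cos (l * u * x) * b + sin (l * u * x) * c)) =
  a * (\int[mu]_x p x) + b * cosT p u + c * sinT p u.
Proof.
move=> pi.
rewrite (_ : (fun x => _) = (fun x => 1 * (a * p x + b * (p x * cos (l * u * x))) + c * (p x * sin (l * u * x)))).
  rewrite Rintegral_lin2 ?Rintegral_lin2 ?mul1r//; last exact: integrable_sinT.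
    exact: integrable_cosT.
  by apply: integrable_lin2 => //; exact: integrable_cosT.
by apply/funext => x; ring.
Qed.

Section nonneg.
Variable p : R -> R.
Hypothesis pi : L1 p.
Hypothesis p0 : forall x, 0 <= p x.
Hypothesis p2 : (\int[mu]_x (p x ^+ 2)%:E < +oo)%E.
Let mp : measurable_fun setT p := integrable_mfun pi.
Let P := \int[mu]_x p x.
Let N2 := \int[mu]_x (p x ^+ 2).

(** The integral over [y] of the nonnegative kernel [p x * p y * (1 + cos (l * (x - y) * u))],
    expanded by the addition formula. Integrating it over [x] produces [power p u] plus the constant
    [P ^+ 2]. *)
Let pairing u x := p x * (P + cos (l * u * x) * cosT p u + sin (l * u * x) * sinT p u).

Let pairingE u x : (\int[mu]_y (p x * p y * (1 + cos (l * (x - y) * u)))%:E = (pairing u x)%:E)%E.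
Proof.
rewrite /pairing [X in (_ * X)%:E](_ : _ = 1 * P + cos (l * u * x) * cosT p u + sin (l * u * x) * sinT p u); last ring.
rewrite -Rintegral_trig// -RintegralZl//; last exact: integrable_trig.
rewrite -integrable_int; last by apply: integrable_scale; exact: integrable_trig.
apply: eq_int => y.
rewrite (_ : l * (x - y) * u = l * u * x - l * u * y); last ring.
rewrite cosB; ring.
Qed.

Let trig_ge0 (e t : R) : 0 <= expR e * (1 + cos t).
Proof. by rewrite mulr_ge0 ?expR_ge0// -lerBlDl sub0r cos_geN1. Qed.

Let pairing_ge0 u x : 0 <= pairing u x.
Proof.
rewrite -lee_fin -pairingE; apply: ge0_int => y.
by rewrite !mulr_ge0// -lerBlDl sub0r cos_geN1.
Qed.

Let int_pairing u : (\int[mu]_x (pairing u x)%:E = (P ^+ 2 + power p u)%:E)%E.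
Proof.
rewrite integrable_int ?Rintegral_trig//; last exact: integrable_trig.
by rewrite /power -/P; congr EFin; ring.
Qed.

(** The Poisson kernel in the variable [l * z], not normalised. *)
Let K (e z : R) := 2 * e / (e ^+ 2 + (l * z) ^+ 2).

Let mK d (T : measurableType d) e (f : T -> R) : 0 < e -> measurable_fun setT f ->
  measurable_fun setT (fun x => K e (f x)).
Proof.
move=> e0 mf; rewrite /K; apply: measurable_funM; first by meas.
have -> : (fun x => (e ^+ 2 + (l * f x) ^+ 2)^-1) = (fun x => expR (- ln (e ^+ 2 + (l * f x) ^+ 2))).
  apply/funext => x; rewrite expRN lnK// posrE.
  by rewrite ltr_pwDl ?exprn_gt0 ?sqr_ge0.
meas; apply: (measurableT_comp (@measurable_ln _)); meas.
Qed.

Let K_ge0 e z : 0 < e -> 0 <= K e z.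
Proof.
by move=> e0; rewrite /K divr_ge0 ?mulr_ge0 ?addr_ge0 ?sqr_ge0// ltW.
Qed.

Let ppK_ge0 e x y : 0 < e -> 0 <= p x * p y * K e (x - y).
Proof. by move=> e0; apply: mulr_ge0; [exact: mulr_ge0|exact: K_ge0]. Qed.

Let KN e z : K e (- z) = K e z.
Proof. by rewrite /K mulrN sqrrN. Qed.

(** Tonelli's theorem is applied to [expR (- (e * |u|)) * p x * p y * (1 + cos (l * (x - y) * u))]
    in the three variables. Integrating over [u] first gives the Poisson kernel, integrating over
    [x] and [y] first gives [power]. Both orders also produce the finite term [P ^+ 2 * (2 / e)],
    which is cancelled. *)
Lemma int_damped_power e : 0 < e ->
  (\int[mu]_u (expR (- (e * `|u|)) * power p u)%:E =
   \int[mu]_x \int[mu]_y (p x * p y * K e (x - y))%:E)%E.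
Proof.
move=> e0.
have mc := measurable_cosT mp; have ms := measurable_sinT mp.
have mpw := measurable_power mp.
have P0 : 0 <= P by apply: Rintegral_ge0.
have H1 : (\int[mu]_u (expR (- (e * `|u|)) * (P ^+ 2 + power p u))%:E =
   \int[mu]_x \int[mu]_y (p x * p y * (2 / e + K e (x - y)))%:E)%E.
  transitivity (\int[mu]_u \int[mu]_x (expR (- (e * `|u|)) * pairing u x)%:E)%E.
    apply: eq_integral => u _; rewrite ge0_intZ ?expR_ge0//; last by rewrite /pairing; meas.
    by rewrite int_pairing EFinM.
  rewrite ge0_int_swap; last 2 first.
  - by rewrite /pairing; meas.
  - by move=> u x; rewrite mulr_ge0 ?expR_ge0.
  apply: eq_integral => x _.
  transitivity (\int[mu]_u \int[mu]_y (expR (- (e * `|u|)) * (p x * p y * (1 + cos (l * (x - y) * u))))%:E)%E.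
    apply: eq_integral => u _; rewrite ge0_intZ ?expR_ge0//.
    - by rewrite pairingE EFinM.
    - by meas.
    - by move=> y; rewrite !mulr_ge0// -lerBlDl sub0r cos_geN1.
  rewrite ge0_int_swap; last 2 first.
  - by meas.
  - by move=> u y; rewrite !mulr_ge0 ?expR_ge0// -lerBlDl sub0r cos_geN1.
  apply: eq_integral => y _.
  rewrite [RHS]EFinM -int_exp_cos// -ge0_intZ//.
  - by apply: eq_int => u; ring.
  - by meas.
  - by rewrite mulr_ge0.
have H2 : (\int[mu]_u (expR (- (e * `|u|)) * (P ^+ 2 + power p u))%:E =
   (P ^+ 2 * (2 / e))%:E + \int[mu]_u (expR (- (e * `|u|)) * power p u)%:E)%E.
  (* At [z = 0] the factor [1 + cos] is the constant 2, so the integral of the bare damping factor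
     is half of this one. *)
  have /esym E0 := @int_exp_cos R e 0 e0.
  have E1 : (\int[mu]_u (expR (- (e * `|u|)))%:E = (2 / e)%:E)%E.
    transitivity (\int[mu]_u (2^-1 * (expR (- (e * `|u|)) * (1 + cos (0 * u))))%:E)%E.
      by apply: eq_int => u; rewrite mul0r cos0; field.
    rewrite ge0_intZ; [|by meas|by nneg|by move=> u; exact: trig_ge0].
    by rewrite -E0 -EFinM; congr EFin; field; rewrite gt_eqF.
  rewrite EFinM -E1 -ge0_intZ; [|by meas|by nneg|by nneg].
  rewrite -ge0_intD; last 4 first.
  - by meas.
  - by meas.
  - by move=> u; rewrite mulr_ge0 ?expR_ge0 ?sqr_ge0.
  - by move=> u; rewrite mulr_ge0 ?expR_ge0 ?power_ge0.
  by apply: eq_int => u; ring.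
have H3 : (\int[mu]_x \int[mu]_y (p x * p y * (2 / e + K e (x - y)))%:E =
  (P ^+ 2 * (2 / e))%:E + \int[mu]_x \int[mu]_y (p x * p y * K e (x - y))%:E)%E.
  transitivity (\int[mu]_x ((P * (2 / e) * p x)%:E + \int[mu]_y (p x * p y * K e (x - y))%:E))%E.
    apply: eq_integral => x _.
    rewrite (_ : P * (2 / e) * p x = (p x * (2 / e)) * P); last ring.
    rewrite EFinM /P -integrable_int// -ge0_intZ//; last by rewrite mulr_ge0// divr_ge0// ltW.
    rewrite -ge0_intD.
    - by apply: eq_int => y; ring.
    - by meas.
    - apply: measurable_funM; first by meas. by apply: mK => //; meas.
    - by nneg.
    - by move=> y; exact: ppK_ge0.
  rewrite ge0_integralD//; first last.
  - apply: (@measurable_int_param _ _ _ (fun z : R * R => p z.1 * p z.2 * K e (z.1 - z.2))).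
      by apply: measurable_funM; [meas|apply: mK => //; meas].
    by move=> z; exact: ppK_ge0.
  - by move=> x _; apply: ge0_int => y; exact: ppK_ge0.
  - by meas.
  - by move=> x _; rewrite lee_fin; nneg.
  rewrite ge0_intZ//; last by rewrite mulr_ge0// divr_ge0// ltW.
  by rewrite integrable_int// -EFinM -/P; congr (_%:E + _)%E; ring.
by move: H1; rewrite H2 H3 => /EFin_addI.
Qed.

Let kap : R := 2 * trigo.pi / `|l|.

Let intK e x : 0 < e -> l != 0 -> (\int[mu]_y (K e (x - y))%:E = kap%:E)%E.
Proof.
move=> e0 l0; rewrite -(int_poisson e0 l0).
rewrite -[RHS](@ge0_int_shift _ (K e) (- x)); last 2 first.
- by apply: mK => //; meas.
- by move=> y; exact: K_ge0.
by apply: eq_int => y; rewrite -KN opprB.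
Qed.

Let err e := (\int[mu]_x \int[mu]_y (K e (x - y) * (p x - p y) ^+ 2)%:E)%E.

(** This is [2 * p x * p y + (p x - p y) ^+ 2 = p x ^+ 2 + p y ^+ 2] integrated against the kernel,
    where each square contributes [kap * N2] because the kernel has mass [kap]. Thus [err e]
    measures how far the damped energy falls short of Plancherel's identity. *)
Let damped_err e : 0 < e -> l != 0 ->
  (2%:E * (\int[mu]_u (expR (- (e * `|u|)) * power p u)%:E) + err e =
   (2 * kap * N2)%:E)%E.
Proof.
move=> e0 l0; rewrite int_damped_power//.
have m1 : measurable_fun setT (fun z : R * R => p z.1 * p z.2 * K e (z.1 - z.2)).
  by apply: measurable_funM; [meas|apply: mK => //; meas].
have m2 : measurable_fun setT (fun z : R * R => K e (z.1 - z.2) * (p z.1 - p z.2) ^+ 2).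
  by apply: measurable_funM; [apply: mK => //; meas|meas].
have m3 : measurable_fun setT (fun z : R * R => p z.1 ^+ 2 * K e (z.1 - z.2)).
  by apply: measurable_funM; [meas|apply: mK => //; meas].
have m4 : measurable_fun setT (fun z : R * R => p z.2 ^+ 2 * K e (z.1 - z.2)).
  by apply: measurable_funM; [meas|apply: mK => //; meas].
have mKx x : measurable_fun setT (fun y : R => K e (x - y)) by apply: mK => //; meas.
have mKy y : measurable_fun setT (fun x : R => K e (x - y)) by apply: mK => //; meas.
have g1 x y : 0 <= p x * p y * K e (x - y) by exact: ppK_ge0.
have g2 x y : 0 <= K e (x - y) * (p x - p y) ^+ 2 by rewrite mulr_ge0 ?sqr_ge0 ?K_ge0.
have g3 x y : 0 <= p x ^+ 2 * K e (x - y) by rewrite mulr_ge0 ?sqr_ge0 ?K_ge0.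
have g4 x y : 0 <= p y ^+ 2 * K e (x - y) by rewrite mulr_ge0 ?sqr_ge0 ?K_ge0.
have kap0 : 0 <= kap by rewrite /kap divr_ge0// mulr_ge0// pi_ge0.
have iN : (\int[mu]_x (p x ^+ 2)%:E = N2%:E)%E by apply: ge0_int_fin => // x; exact: sqr_ge0.
have E3 : (\int[mu]_x \int[mu]_y (p x ^+ 2 * K e (x - y))%:E = (kap * N2)%:E)%E.
  rewrite EFinM -iN -ge0_intZ; [|by meas|by []|by nneg].
  apply: eq_integral => x _; rewrite ge0_intZ; [|exact: mKx|exact: sqr_ge0|by move=> y; exact: K_ge0].
  by rewrite intK// -EFinM mulrC.
have E4 : (\int[mu]_x \int[mu]_y (p y ^+ 2 * K e (x - y))%:E = (kap * N2)%:E)%E.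
  rewrite ge0_int_swap; [|exact: m4|exact: g4].
  rewrite EFinM -iN -ge0_intZ; [|by meas|by []|by nneg].
  apply: eq_integral => y _; rewrite ge0_intZ; [|exact: mKy|exact: sqr_ge0|by move=> x; exact: K_ge0].
  under eq_integral do rewrite -KN opprB.
  by rewrite intK// -EFinM mulrC.
rewrite -ge0_integralZl; [|by []|exact: (measurable_int_param m1)|by move=> x _; exact: ge0_int|by []].
rewrite -ge0_integralD//; first last.
- exact: (measurable_int_param m2).
- by move=> x _; exact: ge0_int.
- by apply: emeasurable_funM; [exact: measurable_cst|exact: (measurable_int_param m1)].
- by move=> x _; rewrite mule_ge0//; exact: ge0_int.
rewrite [RHS](_ : _ = (kap * N2)%:E + (kap * N2)%:E)%E; last first.
  by rewrite -EFinD; congr EFin; ring.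
rewrite -{1}E3 -E4 -ge0_integralD; [|by []|by move=> x _; exact: ge0_int|
  exact: (measurable_int_param m3)|by move=> x _; exact: ge0_int|exact: (measurable_int_param m4)].
apply: eq_integral => x _.
have m1x := measurable_fun_pair2 x m1.
have m2x := measurable_fun_pair2 x m2.
have m3x := measurable_fun_pair2 x m3.
have m4x := measurable_fun_pair2 x m4.
rewrite -ge0_intZ// -ge0_intD//; first last.
- by move=> y; rewrite mulr_ge0.
- by apply: measurable_funM => //; meas.
rewrite -ge0_intD//.
by apply: eq_int => y; ring.
Qed.

(** Away from the origin the kernel is [e] times a fixed integrable function. With
    [a = (l * z) ^+ 2] and [c = (l * dl) ^+ 2], the hypothesis [c <= a] gives
    [1 + a <= (1 + 1 / c) * (e ^+ 2 + a)]. *)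
Let K_tail e dl z : 0 < e -> l != 0 -> 0 < dl -> dl <= `|z| ->
  K e z <= e * (1 + 1 / (l * dl) ^+ 2) * K 1 z.
Proof.
move=> e0 l0 dl0 zdl.
have ldl : 0 < (l * dl) ^+ 2 by rewrite exprn_even_gt0//= mulf_neq0// gt_eqF.
have lz : (l * dl) ^+ 2 <= (l * z) ^+ 2.
  rewrite !exprMn ler_wpM2l ?sqr_ge0// -[z ^+ 2]real_normK ?num_real//.
  by rewrite ler_pXn2r ?nnegrE// ltW.
rewrite /K; move: lz ldl; set a := (l * z) ^+ 2; set c := (l * dl) ^+ 2 => lz c0.
have a0 : 0 < a by apply: lt_le_trans lz.
have ea0 : 0 < e ^+ 2 + a by rewrite addr_gt0// exprn_gt0.
rewrite ler_pdivrMr// expr1n.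
rewrite (_ : e * (1 + 1 / c) * (2 * 1 / (1 + a)) * (e ^+ 2 + a) =
  2 * e * (((1 + c^-1) * (e ^+ 2 + a)) / (1 + a))); last first.
  by field; rewrite !gt_eqF// addr_gt0.
apply: ler_peMr; first by nneg.
rewrite ler_pdivlMr ?addr_gt0// mul1r.
have ca : 1 <= c^-1 * a by rewrite mulrC ler_pdivlMr// mul1r.
have ce : 0 <= c^-1 * e ^+ 2 by nneg.
have := sqr_ge0 e; rewrite mulrDl mulrDr mul1r; lra.
Qed.

(** After the substitution [x = z + y], [err e] is the average over [z], against the kernel, of the
    squared L2 increment of [p]. The increment is small for [|z| < dl] by continuity of
    translations; elsewhere it is at most [4 * N2] and the kernel is of order [e]. *)
Let err_small e0 : 0 < e0 -> l != 0 -> exists2 e, 0 < e & (err e <= e0%:E)%E.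
Proof.
move=> e00 l0.
have kap0 : 0 < kap by rewrite /kap divr_gt0 ?mulr_gt0 ?pi_gt0// normr_gt0.
have N20 : 0 <= N2 by apply: Rintegral_ge0 => x _; exact: sqr_ge0.
have iN : (\int[mu]_x (p x ^+ 2)%:E = N2%:E)%E by apply: ge0_int_fin => // x; exact: sqr_ge0.
have [|dl dl0 hdl] := @L2_shift_cvg R p mp p2 (e0 / (2 * kap)).
  by rewrite divr_gt0// mulr_gt0.
(* The near part contributes [kap * e0 / (2 * kap)], the far part at most [e * C], and [e] is chosen
   to make each equal to [e0 / 2]. Writing [4 * N2 + 1] keeps [C] positive even if [p] vanishes
   almost everywhere. *)
pose C := (1 + 1 / (l * dl) ^+ 2) * (4 * N2 + 1) * kap.
have ldl : 0 < (l * dl) ^+ 2 by rewrite exprn_even_gt0//= mulf_neq0// gt_eqF.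
have C0 : 0 < C.
  apply: mulr_gt0 => //; apply: mulr_gt0; first by rewrite addr_gt0// divr_gt0.
  by rewrite ltr_wpDl// mulr_ge0.
pose e := e0 / (2 * C).
have e_gt0 : 0 < e by rewrite divr_gt0// mulr_gt0.
exists e => //.
have m2 : measurable_fun setT (fun z : R * R => K e z.2 * (p (z.2 + z.1) - p z.1) ^+ 2).
  by apply: measurable_funM; [apply: mK => //; meas|meas].
have -> : err e = (\int[mu]_z ((K e z)%:E * \int[mu]_y ((p (y + z)%R - p y) ^+ 2)%:E))%E.
  rewrite /err ge0_int_swap; last 2 first.
  - by apply: measurable_funM; [apply: mK => //; meas|meas].
  - by move=> x y; rewrite mulr_ge0 ?sqr_ge0 ?K_ge0.
  transitivity (\int[mu]_y \int[mu]_z (K e z * (p (z + y)%R - p y) ^+ 2)%:E)%E.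
    apply: eq_integral => y _.
    rewrite -(@ge0_int_shift _ _ y); last 2 first.
    - by apply: measurable_funM; [apply: mK => //; meas|meas].
    - by move=> x; rewrite mulr_ge0 ?sqr_ge0 ?K_ge0.
    by apply: eq_int => z; rewrite addrK.
  rewrite ge0_int_swap//; last by move=> x y; rewrite mulr_ge0 ?sqr_ge0 ?K_ge0.
  apply: eq_integral => z _.
  have mz : measurable_fun setT (fun x : R => (p (z + x) - p x) ^+ 2).
    by meas.
  rewrite ge0_intZ; [|exact: mz|exact: K_ge0|by nneg].
  by congr (_ * _)%E; apply: eq_int => y; rewrite (addrC z).
have c1 : 0 <= e0 / (2 * kap) by nneg.
have c2 : 0 <= e * (1 + 1 / (l * dl) ^+ 2) * (4 * N2 + 1) by nneg.
have ub z : (\int[mu]_y ((p (y + z)%R - p y) ^+ 2)%:E <= (4 * N2)%:E)%E.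
  apply: (@le_trans _ _ (\int[mu]_y (2 * (p (y + z)%R ^+ 2) + 2 * (p y ^+ 2))%:E)%E).
    apply: ge0_int_le; [by meas|by meas|by nneg|move=> y].
    rewrite -subr_ge0 (_ : _ - _ = (p (y + z) + p y) ^+ 2); last ring.
    exact: sqr_ge0.
  rewrite ge0_intD; [|by meas|by meas|by nneg|by nneg].
  rewrite !ge0_intZ; [|by meas|by nneg|by nneg|by meas|by nneg|by nneg].
  rewrite (@ge0_int_shift _ (fun x => p x ^+ 2)); [|by meas|by nneg].
  by rewrite iN -!EFinM -EFinD lee_fin; lra.
have K1 z : dl <= `|z| -> K e z <= e * (1 + 1 / (l * dl) ^+ 2) * K 1 z by exact: K_tail.
apply: (@le_trans _ _ (\int[mu]_z ((e0 / (2 * kap)) * K e z + e * (1 + 1 / (l * dl) ^+ 2) * (4 * N2 + 1) * K 1 z)%:E)%E).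
  apply: ge0_le_integral => //.
  - by move=> z _; rewrite mule_ge0 ?lee_fin ?K_ge0//; apply: ge0_int => y; exact: sqr_ge0.
  - apply: emeasurable_funM; first by apply/measurable_EFinP; apply: mK => //; meas.
    apply: (@measurable_int_param _ _ _ (fun w : R * R => (p (w.2 + w.1) - p w.2) ^+ 2)).
      by meas.
    by move=> w; exact: sqr_ge0.
  - apply/measurable_EFinP; apply: measurable_funD; apply: measurable_funM; try exact: measurable_cst.
      by apply: mK => //; meas.
    by apply: mK => //; meas.
  move=> z _; rewrite EFinD.
  have [zdl|zdl] := ltP `|z| dl.
    rewrite -[leLHS]adde0; apply: leeD; last first.
      by rewrite lee_fin; apply: mulr_ge0 => //; exact: K_ge0.
    rewrite muleC -[leRHS]/((e0 / (2 * kap))%:E * (K e z)%:E)%E.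
    by apply: lee_wpmul2r; [rewrite lee_fin; exact: K_ge0|exact: hdl].
  rewrite -[leLHS]add0e; apply: leeD.
    by rewrite lee_fin; apply: mulr_ge0 => //; exact: K_ge0.
  apply: (@le_trans _ _ ((K e z)%:E * (4 * N2 + 1)%:E)%E).
    apply: lee_wpmul2l; first by rewrite lee_fin; exact: K_ge0.
    by apply: (le_trans (ub z)); rewrite lee_fin lerDl.
  rewrite -EFinM lee_fin [leRHS]mulrAC; apply: ler_wpM2r; last exact: K1.
  by rewrite addr_ge0// mulr_ge0.
have iK r : 0 < r -> (\int[mu]_z (K r z)%:E = kap%:E)%E by move=> r0; exact: int_poisson.
have mKid r : 0 < r -> measurable_fun setT (K r) by move=> r0; apply: (mK r0); meas.
have Kg r z : 0 < r -> 0 <= K r z by exact: K_ge0.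
rewrite ge0_intD; first last.
- by move=> z; rewrite mulr_ge0 ?Kg.
- by move=> z; rewrite mulr_ge0 ?Kg.
- by apply: measurable_funM; [meas|exact: mKid].
- by apply: measurable_funM; [meas|exact: mKid].
rewrite (ge0_intZ mu (mKid _ e_gt0) c1 (fun z => Kg _ z e_gt0)).
rewrite (ge0_intZ mu (mKid _ ltr01) c2 (fun z => Kg _ z ltr01)).
rewrite !iK// -!EFinM -EFinD lee_fin le_eqVlt; apply/orP; left; apply/eqP.
rewrite (_ : e * _ * _ * kap = e * C); last by rewrite /C; ring.
by rewrite /e; field; rewrite !gt_eqF.
Qed.

(** For the upper bound, [err] is nonnegative and the damping is removed by monotone convergence
    along [e = 1 / (n + 1)]. For the lower bound, the damped energy is at most the full energy, and
    [err] can be made arbitrarily small. *)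
Lemma plancherel_ge0 : l != 0 ->
  (\int[mu]_u (power p u)%:E = kap%:E * \int[mu]_x (p x ^+ 2)%:E)%E.
Proof.
move=> l0.
have mpw := measurable_power mp.
have iN : (\int[mu]_x (p x ^+ 2)%:E = N2%:E)%E by apply: ge0_int_fin => // x; exact: sqr_ge0.
rewrite iN -EFinM; apply/eqP; rewrite eq_le; apply/andP; split.
  have -> : (\int[mu]_u (power p u)%:E = \int[mu]_u limn (fun n => (expR (- (n.+1%:R^-1 * `|u|)) * power p u)%:E))%E.
    apply: eq_integral => u _; apply/esym/cvg_lim => //.
    apply: cvg_EFin; first by near=> n.
    rewrite -[X in _ --> X]mul1r; apply: cvgM; last exact: cvg_cst.
    have h1 : (- (n.+1%:R^-1 * `|u|)) @[n --> \oo] --> (0 : R).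
      rewrite -oppr0; apply: cvgN; rewrite -(mul0r `|u|); apply: cvgM; last exact: cvg_cst.
      exact: cvg_harmonic.
    have := @continuous_expR R 0; rewrite /continuous_at expR0 => h.
    exact: (cvg_comp _ _ h1 h).
  rewrite monotone_convergence//; first last.
  - move=> u _ n n' nn'; rewrite lee_fin ler_wpM2r ?power_ge0// ler_expR lerN2 ler_wpM2r//.
    by rewrite lef_pV2 ?posrE// ler_nat.
  - by move=> n u _; rewrite lee_fin mulr_ge0 ?expR_ge0 ?power_ge0.
  - by move=> n; meas.
  apply: lime_le.
    apply: ereal_nondecreasing_is_cvgn => n n' nn'.
    apply: ge0_int_le; [by meas|by meas|by move=> u; rewrite mulr_ge0 ?expR_ge0 ?power_ge0|move=> u].
    rewrite ler_wpM2r ?power_ge0// ler_expR lerN2 ler_wpM2r//.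
    by rewrite lef_pV2 ?posrE// ler_nat.
  near=> n.
  have n0 : 0 < n.+1%:R^-1 :> R by rewrite invr_gt0.
  have := damped_err n0 l0.
  set I := (\int[mu]_u _)%E; move=> H.
  have err0 : (0 <= err n.+1%:R^-1)%E.
    by apply: integral_ge0 => x _; apply: ge0_int => y; rewrite mulr_ge0 ?K_ge0 ?sqr_ge0.
  have : (2%:E * I <= 2%:E * (kap * N2)%:E)%E.
    by rewrite -EFinM mulrA -H leeDl.
  by rewrite lee_pmul2l.
apply/lee_addgt0Pr => e0 e00.
(* The identity [damped_err] carries a factor 2, so an error of [2 * e0] there is an error of [e0]
   here. *)
have [|e e_gt0 herr] := @err_small (2 * e0) _ l0; first by rewrite mulr_gt0.
have := damped_err e_gt0 l0.
set I := (\int[mu]_u (expR _ * _)%:E)%E; move=> H.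
have leI : (I <= \int[mu]_u (power p u)%:E)%E.
  apply: ge0_int_le => //; [by meas|by move=> u; rewrite mulr_ge0 ?expR_ge0 ?power_ge0|move=> u].
  by rewrite ler_piMl ?power_ge0// expR_le1 oppr_le0 mulr_ge0// ltW.
have : (2%:E * (kap * N2)%:E <= 2%:E * (\int[mu]_u (power p u)%:E + e0%:E))%E.
  rewrite -EFinM mulrA -H [leRHS]ge0_muleDr//; last 2 first.
  - by apply: ge0_int => u; exact: power_ge0.
  - by rewrite lee_fin ltW.
  by apply: leeD; [rewrite lee_pmul2l|rewrite -EFinM].
by rewrite lee_pmul2l.
Unshelve. all: by end_near. Qed.

End nonneg.

(** With [pp] and [pn] the positive and negative parts, [p = pp - pn] and [|p| = pp + pn]. The
    parallelogram law expresses [power p] through the powers of [|p|], [pp] and [pn], which are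
    nonnegative functions, and all quantities being finite one can solve for it. *)
Lemma plancherel_real p : l != 0 -> L1 p -> (\int[mu]_x (p x ^+ 2)%:E < +oo)%E ->
  (\int[mu]_u (power p u)%:E = (2 * pi / `|l|)%:E * \int[mu]_x (p x ^+ 2)%:E)%E.
Proof.
move=> l0 pi p2.
have mp := integrable_mfun pi.
pose q x := `|p x|.
have qi : L1 q by exact: integrable_norm.
have mq := integrable_mfun qi.
pose pp x := 2^-1 * p x + 2^-1 * q x.
pose pn x := - 2^-1 * p x + 2^-1 * q x.
have ppi : L1 pp by exact: integrable_lin2.
have pni : L1 pn by exact: integrable_lin2.
have mpp := integrable_mfun ppi.
have mpn := integrable_mfun pni.
have pp0 x : 0 <= pp x by have := lerNnormlW; have := ler_norm (- p x); rewrite /pp /q normrN; lra.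
have pn0 x : 0 <= pn x by have := ler_norm (p x); rewrite /pn /q; lra.
have q2 x : q x ^+ 2 = p x ^+ 2 by rewrite /q real_normK ?num_real.
have sq x : pp x ^+ 2 + pn x ^+ 2 = p x ^+ 2.
  rewrite [RHS](_ : _ = 2^-1 * p x ^+ 2 + 2^-1 * p x ^+ 2); last by field.
  by rewrite -{2}q2 /pp /pn; field.
have pp2 : (\int[mu]_x (pp x ^+ 2)%:E < +oo)%E.
  apply: le_lt_trans p2; apply: ge0_int_le; [by meas|by meas|by nneg|move=> x].
  by rewrite -sq lerDl sqr_ge0.
have pn2 : (\int[mu]_x (pn x ^+ 2)%:E < +oo)%E.
  apply: le_lt_trans p2; apply: ge0_int_le; [by meas|by meas|by nneg|move=> x].
  by rewrite -sq lerDr sqr_ge0.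
have q2i : (\int[mu]_x (q x ^+ 2)%:E < +oo)%E by under eq_integral do rewrite q2.
have Hp := plancherel_ge0 ppi pp0 pp2 l0.
have Hn := plancherel_ge0 pni pn0 pn2 l0.
have Hq := plancherel_ge0 qi (fun x => normr_ge0 (p x)) q2i l0.
have mw h : measurable_fun setT h -> measurable_fun setT (power h) by exact: measurable_power.
have mwp := mw _ mp; have mwq := mw _ mq; have mwpp := mw _ mpp; have mwpn := mw _ mpn.
have kap0 : 0 <= 2 * trigo.pi / `|l| :> R by rewrite divr_ge0// mulr_ge0// pi_ge0.
have par u : power p u + power q u = 2 * power pp u + 2 * power pn u.
  by rewrite /power !cosT_lin// !sinT_lin//; field.
have E1 : (\int[mu]_u (power p u)%:E + \int[mu]_u (power q u)%:E =
   2%:E * \int[mu]_u (power pp u)%:E + 2%:E * \int[mu]_u (power pn u)%:E)%E.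
  have w0 := power_ge0.
  rewrite -ge0_intD//.
  rewrite -(ge0_intZ mu (k := 2) mwpp _ (w0 pp))// -(ge0_intZ mu (k := 2) mwpn _ (w0 pn))//.
  rewrite -ge0_intD; [|by meas|by meas|by nneg|by nneg].
  by apply: eq_int => u; rewrite par.
move: E1; rewrite Hp Hn Hq.
have fin (h : R -> R) : (\int[mu]_x (h x ^+ 2)%:E < +oo)%E ->
    (\int[mu]_x (h x ^+ 2)%:E = (\int[mu]_x (h x ^+ 2))%:E)%E.
  by move=> h2; apply: ge0_int_fin => // x; exact: sqr_ge0.
have E2 : (\int[mu]_x (p x ^+ 2)%:E =
   \int[mu]_x (pp x ^+ 2)%:E + \int[mu]_x (pn x ^+ 2)%:E)%E.
  rewrite -ge0_intD; [|by meas|by meas|by nneg|by nneg].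
  by apply: eq_int => x; rewrite sq.
have E3 : (\int[mu]_x (q x ^+ 2)%:E = \int[mu]_x (p x ^+ 2)%:E)%E by apply: eq_int.
rewrite E3 E2 (fin _ pp2) (fin _ pn2) -EFinD -!EFinM -EFinD.
set A := (\int[mu]_u (power p u)%:E)%E.
case: A => [A||]//; rewrite -EFinD => -[] H; congr EFin.
by rewrite -[LHS](addrK (2 * trigo.pi / `|l| * (\int[mu]_x pp x ^+ 2 + \int[mu]_x pn x ^+ 2))) H; ring.
Qed.

End real_plancherel.

(** * Plancherel for complex functions *)

Local Open Scope complex_scope.

Section complex_facts.
Variable R : realType.
Implicit Types (z w : R[i]) (x y : R).

Lemma cmod2E z : cmod z ^+ 2 = complex.Re z ^+ 2 + complex.Im z ^+ 2.
Proof. by case: z => a b; rewrite /cmod /= sqr_sqrtr// addr_ge0 ?sqr_ge0. Qed.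

Lemma ReM z w : complex.Re (z * w) = complex.Re z * complex.Re w - complex.Im z * complex.Im w.
Proof. by case: z w => [a b] [c d]. Qed.

Lemma ImM z w : complex.Im (z * w) = complex.Re z * complex.Im w + complex.Im z * complex.Re w.
Proof. by case: z w => [a b] [c d]. Qed.

Lemma ReB z w : complex.Re (z - w) = complex.Re z - complex.Re w.
Proof. by case: z w => [a b] [c d]. Qed.

Lemma ImB z w : complex.Im (z - w) = complex.Im z - complex.Im w.
Proof. by case: z w => [a b] [c d]. Qed.

Lemma complex_eq z w : complex.Re z = complex.Re w -> complex.Im z = complex.Im w -> z = w.
Proof. by case: z w => [a b] [c d] /= -> ->. Qed.

Lemma cmod2M z w : cmod (z * w) ^+ 2 = cmod z ^+ 2 * cmod w ^+ 2.
Proof. by rewrite !cmod2E ReM ImM; ring. Qed.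

Lemma cmod2_ge0 z : 0 <= cmod z ^+ 2.
Proof. exact: sqr_ge0. Qed.

Lemma cmod2_conj z : cmod (conjc z) ^+ 2 = cmod z ^+ 2.
Proof. by rewrite !cmod2E; case: z => a b /=; ring. Qed.

Lemma cmod2N z : cmod (- z) ^+ 2 = cmod z ^+ 2.
Proof. by rewrite !cmod2E; case: z => a b /=; ring. Qed.

Lemma expiD x y : expi (x + y) = expi x * expi y.
Proof. by apply: complex_eq; rewrite ?ReM ?ImM/= ?cosD ?sinD; ring. Qed.

Lemma expi0 : expi 0 = 1 :> R[i].
Proof. by rewrite /expi cos0 sin0. Qed.

Lemma cmod2_expi x : cmod (expi x) ^+ 2 = 1.
Proof. by rewrite cmod2E /= cos2Dsin2. Qed.

Lemma cmod2_expiB1 x : cmod (expi x - 1) ^+ 2 = 2 - 2 * cos x.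
Proof.
rewrite cmod2E ReB ImB /=; have := cos2Dsin2 x; set c := cos x; set s := sin x => cs.
rewrite subr0 (_ : s ^+ 2 = 1 - c ^+ 2); last by rewrite -cs; ring.
ring.
Qed.

Lemma cmod2_addl z w : cmod (z + w) ^+ 2 <= 2 * cmod z ^+ 2 + 2 * cmod w ^+ 2.
Proof.
case: z w => [a b] [c d]; rewrite !cmod2E /= -subr_ge0.
rewrite (_ : _ - _ = (a - c) ^+ 2 + (b - d) ^+ 2); last ring.
by rewrite addr_ge0// sqr_ge0.
Qed.

End complex_facts.

(** * Measurability and integration of complex-valued functions *)

Section complex_integral.
Variable R : realType.
Local Notation mu := (@lebesgue_measure R).
Local Notation L1 p := (mu.-integrable setT (EFin \o p)).
Local Notation Re := complex.Re.
Local Notation Im := complex.Im.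
Implicit Types (h k : R -> R[i]) (z : R[i]).

Definition cmeasurable d (T : measurableType d) (h : T -> R[i]) :=
  measurable_fun setT (fun x => Re (h x)) /\ measurable_fun setT (fun x => Im (h x)).

Definition cintegrable h := L1 (fun x => Re (h x)) /\ L1 (fun x => Im (h x)).

Lemma cmeasurable_cmod2 d (T : measurableType d) (h : T -> R[i]) :
  cmeasurable h -> measurable_fun setT (fun x => cmod (h x) ^+ 2).
Proof. move=> [mr mi].
rewrite (_ : (fun x => _) = (fun x => Re (h x) ^+ 2 + Im (h x) ^+ 2)); first by meas.
by apply/funext => x; rewrite cmod2E. Qed.

Lemma cmeasurableM d (T : measurableType d) (h k : T -> R[i]) :
  cmeasurable h -> cmeasurable k -> cmeasurable (fun x => h x * k x).
Proof.
move=> [hr hi] [kr ki]; split.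
- rewrite (_ : (fun x => _) = (fun x => Re (h x) * Re (k x) - Im (h x) * Im (k x))); first by meas.
  by apply/funext => x; rewrite ReM.
- rewrite (_ : (fun x => _) = (fun x => Re (h x) * Im (k x) + Im (h x) * Re (k x))); first by meas.
  by apply/funext => x; rewrite ImM.
Qed.

Lemma cmeasurableB d (T : measurableType d) (h k : T -> R[i]) :
  cmeasurable h -> cmeasurable k -> cmeasurable (fun x => h x - k x).
Proof.
move=> [hr hi] [kr ki]; split.
- rewrite (_ : (fun x => _) = (fun x => Re (h x) - Re (k x))); first by meas.
  by apply/funext => x; rewrite ReB.
- rewrite (_ : (fun x => _) = (fun x => Im (h x) - Im (k x))); first by meas.
  by apply/funext => x; rewrite ImB.
Qed.

Lemma cmeasurable_cst d (T : measurableType d) z : cmeasurable (fun _ : T => z).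
Proof. by split; exact: measurable_cst. Qed.

Lemma cmeasurable_conj d (T : measurableType d) (h : T -> R[i]) :
  cmeasurable h -> cmeasurable (fun x => conjc (h x)).
Proof.
move=> [hr hi]; split.
- by rewrite (_ : (fun x => _) = (fun x => Re (h x)))//; apply/funext => x; case: (h x).
- rewrite (_ : (fun x => _) = (fun x => - Im (h x))); first by meas.
  by apply/funext => x; case: (h x).
Qed.

Lemma cmeasurable_expi d (T : measurableType d) (p : T -> R) :
  measurable_fun setT p -> cmeasurable (fun x => expi (p x)).
Proof. by move=> mp; split => /=; meas. Qed.

Lemma cmeasurable_comp d d' (T : measurableType d) (T' : measurableType d') (p : T -> T') (h : T' -> R[i]) :
  cmeasurable h -> measurable_fun setT p -> cmeasurable (fun x => h (p x)).
Proof.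
by move=> [hr hi] mp; split; [exact: (measurableT_comp hr)|exact: (measurableT_comp hi)].
Qed.

Lemma cintegrable_measurable h : cintegrable h -> cmeasurable h.
Proof. by move=> [hr hi]; split; [exact: (integrable_mfun hr)|exact: (integrable_mfun hi)]. Qed.

Lemma cintegrableZ z h : cintegrable h -> cintegrable (fun x => z * h x).
Proof.
move=> [hr hi]; split.
- rewrite (_ : (fun x => _) = (fun x => Re z * Re (h x) + (- Im z) * Im (h x))).
    exact: integrable_lin2.
  by apply/funext => x; rewrite ReM; ring.
- rewrite (_ : (fun x => _) = (fun x => Re z * Im (h x) + Im z * Re (h x))).
    exact: integrable_lin2.
  by apply/funext => x; rewrite ImM; ring.
Qed.

Lemma cintZ z h : cintegrable h -> cint (fun x => z * h x) = z * cint h.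
Proof.
move=> [hr hi]; apply: complex_eq; rewrite ?ReM ?ImM /=.
- rewrite (_ : (fun x => _) = (fun x => Re z * Re (h x) + (- Im z) * Im (h x))).
    by rewrite Rintegral_lin2// mulNr.
  by apply/funext => x; rewrite ReM; ring.
- rewrite (_ : (fun x => _) = (fun x => Re z * Im (h x) + Im z * Re (h x))).
    by rewrite Rintegral_lin2.
  by apply/funext => x; rewrite ImM; ring.
Qed.

Lemma cintegrableB h k : cintegrable h -> cintegrable k -> cintegrable (fun x => h x - k x).
Proof.
move=> [hr hi] [kr ki]; split.
- rewrite (_ : (fun x => _) = (fun x => 1 * Re (h x) + (- 1) * Re (k x))).
    exact: integrable_lin2.
  by apply/funext => x; rewrite ReB; ring.
- rewrite (_ : (fun x => _) = (fun x => 1 * Im (h x) + (- 1) * Im (k x))).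
    exact: integrable_lin2.
  by apply/funext => x; rewrite ImB; ring.
Qed.

Lemma cintB h k : cintegrable h -> cintegrable k ->
  cint (fun x => h x - k x) = cint h - cint k.
Proof.
move=> [hr hi] [kr ki]; apply: complex_eq; rewrite ?ReB ?ImB /=.
- rewrite (_ : (fun x => _) = (fun x => 1 * Re (h x) + (- 1) * Re (k x))).
    by rewrite Rintegral_lin2// mul1r mulN1r.
  by apply/funext => x; rewrite ReB; ring.
- rewrite (_ : (fun x => _) = (fun x => 1 * Im (h x) + (- 1) * Im (k x))).
    by rewrite Rintegral_lin2// mul1r mulN1r.
  by apply/funext => x; rewrite ImB; ring.
Qed.

Lemma cint_shift h r : cintegrable h -> cint (fun x => h (x + r)) = cint h.
Proof.
move=> [hr hi]; apply: complex_eq => /=.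
- exact: (Rintegral_shift r hr).
- exact: (Rintegral_shift r hi).
Qed.

Lemma cintegrable_shift h r : cintegrable h -> cintegrable (fun x => h (x + r)).
Proof.
move=> [hr hi]; split.
- exact: (integrable_shift r hr).
- exact: (integrable_shift r hi).
Qed.

Lemma cintegrable_expi h (p : R -> R) : cintegrable h -> measurable_fun setT p ->
  cintegrable (fun x => h x * expi (p x)).
Proof.
move=> [hr hi] mp.
have c1 (q : R -> R) : L1 q -> L1 (fun x => q x * cos (p x)).
  by move=> qi; apply: integrable_mul_bounded => // [|x]; [meas|exact: norm_cos_le1].
have s1 (q : R -> R) : L1 q -> L1 (fun x => q x * sin (p x)).
  by move=> qi; apply: integrable_mul_bounded => // [|x]; [meas|exact: norm_sin_le1].
split.
- rewrite (_ : (fun x => _) = (fun x => 1 * (Re (h x) * cos (p x)) + (- 1) * (Im (h x) * sin (p x)))).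
    by apply: integrable_lin2; [exact: c1|exact: s1].
  by apply/funext => x; rewrite ReM /=; ring.
- rewrite (_ : (fun x => _) = (fun x => 1 * (Re (h x) * sin (p x)) + 1 * (Im (h x) * cos (p x)))).
    by apply: integrable_lin2; [exact: s1|exact: c1].
  by apply/funext => x; rewrite ImM /=; ring.
Qed.

Lemma eq_cint h k : h =1 k -> cint h = cint k.
Proof. by move=> /funext ->. Qed.

End complex_integral.

(** * The complex Fourier transform at scale [l] *)

Section fourier.
Variable R : realType.
Local Notation mu := (@lebesgue_measure R).
Local Notation L1 p := (mu.-integrable setT (EFin \o p)).
Local Notation Re := complex.Re.
Local Notation Im := complex.Im.
Implicit Types (h k : R -> R[i]) (z : R[i]).
Variable l : R.

Definition FT h (u : R) : R[i] := cint (fun x => h x * expi (- (l * u * x))).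

Lemma Re_FT h u : cintegrable h ->
  Re (FT h u) = cosT l (fun x => Re (h x)) u + sinT l (fun x => Im (h x)) u.
Proof.
move=> [hr hi]; rewrite /FT /=.
rewrite -[X in X + _]mul1r -[X in _ + X]mul1r -Rintegral_lin2; last 2 first.
- exact: integrable_cosT.
- exact: integrable_sinT.
by apply: eq_Rintegral => x _; rewrite ReM /= cosN sinN; ring.
Qed.

Lemma Im_FT h u : cintegrable h ->
  Im (FT h u) = cosT l (fun x => Im (h x)) u - sinT l (fun x => Re (h x)) u.
Proof.
move=> [hr hi]; rewrite /FT /=.
rewrite -[X in X - _]mul1r -[X in _ + X]mulN1r -Rintegral_lin2; last 2 first.
- exact: integrable_cosT.
- exact: integrable_sinT.
by apply: eq_Rintegral => x _; rewrite ImM /= cosN sinN; ring.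
Qed.

Lemma cosT_opp (p : R -> R) u : cosT l p (- u) = cosT l p u.
Proof. by apply: eq_Rintegral => x _; rewrite mulrN mulNr cosN. Qed.

Lemma sinT_opp (p : R -> R) u : L1 p -> sinT l p (- u) = - sinT l p u.
Proof.
move=> pi; rewrite -[RHS]mulN1r -RintegralZl//; last exact: integrable_sinT.
by apply: eq_Rintegral => x _; rewrite mulrN mulNr sinN; ring.
Qed.

Lemma cmeasurable_FT h : cintegrable h -> cmeasurable (FT h).
Proof.
move=> hi; have [mr mi] := cintegrable_measurable hi; split.
- under eq_fun do rewrite Re_FT//.
  by apply: measurable_funD; [exact: measurable_cosT|exact: measurable_sinT].
- under eq_fun do rewrite Im_FT//.
  by apply: measurable_funB; [exact: measurable_cosT|exact: measurable_sinT].
Qed.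

(** The cross terms between the real and the imaginary part of [h] are odd in [u], as [cosT] is even
    and [sinT] odd. Adding the values at [u] and [- u] removes them, and reflection leaves the
    integral unchanged. *)
Lemma plancherel h : l != 0 -> cintegrable h ->
  (\int[mu]_x (cmod (h x) ^+ 2)%:E < +oo)%E ->
  (\int[mu]_u (cmod (FT h u) ^+ 2)%:E =
   (2 * pi / `|l|)%:E * \int[mu]_x (cmod (h x) ^+ 2)%:E)%E.
Proof.
move=> l0 hI h2; have [hr hi] := hI.
have [mr mi] := cintegrable_measurable hI.
have mF := cmeasurable_cmod2 (cmeasurable_FT hI).
set F := fun u => cmod (FT h u) ^+ 2.
have kap0 : 0 <= 2 * pi / `|l| by rewrite divr_ge0// mulr_ge0// pi_ge0.
have h2E : (\int[mu]_x (cmod (h x) ^+ 2)%:E =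
    \int[mu]_x (Re (h x) ^+ 2)%:E + \int[mu]_x (Im (h x) ^+ 2)%:E)%E.
  rewrite -ge0_intD; [|by meas|by meas|by nneg|by nneg].
  by apply: eq_int => x; rewrite cmod2E.
have r2 : (\int[mu]_x (Re (h x) ^+ 2)%:E < +oo)%E.
  by apply: le_lt_trans h2; rewrite h2E leeDl//; apply: ge0_int; nneg.
have i2 : (\int[mu]_x (Im (h x) ^+ 2)%:E < +oo)%E.
  by apply: le_lt_trans h2; rewrite h2E leeDr//; apply: ge0_int; nneg.
have mwr := measurable_power l mr.
have mwi := measurable_power l mi.
have w0 := power_ge0 l.
have E1 : (\int[mu]_u (F u)%:E + \int[mu]_u (F u)%:E =
  2%:E * (\int[mu]_u (power l (fun x => Re (h x)) u)%:E + \int[mu]_u (power l (fun x => Im (h x)) u)%:E))%E.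
  rewrite -{2}(ge0_int_opp mF (fun=> cmod2_ge0 _)).
  rewrite -ge0_intD; [|exact: mF| |by nneg|by nneg]; last first.
    by apply: (measurableT_comp mF); meas.
  rewrite -ge0_intD// -ge0_intZ//; [|by meas|by move=> u; exact: addr_ge0].
  apply: eq_int => u; rewrite /F !cmod2E !Re_FT// !Im_FT// !cosT_opp !sinT_opp//.
  by rewrite /power; ring.
have {E1}E1 : (2%:E * \int[mu]_u (F u)%:E =
  2%:E * (\int[mu]_u (power l (fun x => Re (h x)) u)%:E + \int[mu]_u (power l (fun x => Im (h x)) u)%:E))%E.
  rewrite -E1 -ge0_intD; [|exact: mF|exact: mF|by nneg|by nneg].
  rewrite -ge0_intZ; [|exact: mF|by []|by nneg].
  by apply: eq_int => u; ring.
move: E1 => /(congr1 (fun w => (2^-1)%:E * w)%E).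
rewrite !muleA -EFinM mulVf// !mul1e => ->.
rewrite !plancherel_real// h2E [RHS]ge0_muleDr; [by []|by apply: ge0_int => x; exact: sqr_ge0..].
Qed.

Lemma FT_shift h (th r u : R) : cintegrable h ->
  FT (fun x => expi th * h (x + r) - h x) u = (expi (th + l * u * r) - 1) * FT h u.
Proof.
move=> hi.
have hE : cintegrable (fun x => h x * expi (- (l * u * x))).
  by apply: cintegrable_expi => //; meas.
rewrite mulrBl mul1r -cintZ//.
rewrite -(cint_shift r (cintegrableZ _ hE)) -cintB//; last first.
  exact: (cintegrable_shift r (cintegrableZ _ hE)).
apply: eq_cint => x /=.
rewrite mulrBl; congr (_ - _).
rewrite (_ : - (l * u * x) = l * u * r + - (l * u * (x + r))); last ring.
by rewrite !expiD; ring.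
Qed.

(** Translation by [r] multiplies the transform by a phase, so the increment has the multiplier
    [expi y - 1], whose squared modulus is the squared chord [2 - 2 * cos y]. The free phase [th]
    serves to move the origin of frequencies. *)
Lemma plancherel_shift h (th r : R) : l != 0 -> cintegrable h ->
  (\int[mu]_x (cmod (expi th * h (x + r)%R - h x) ^+ 2)%:E < +oo)%E ->
  (\int[mu]_u ((2 - 2 * cos (th + l * u * r)) * cmod (FT h u) ^+ 2)%:E =
   (2 * pi / `|l|)%:E * \int[mu]_x (cmod (expi th * h (x + r)%R - h x) ^+ 2)%:E)%E.
Proof.
move=> l0 hi h2; rewrite -plancherel//; last first.
  by apply: cintegrableB => //; apply: cintegrableZ; exact: cintegrable_shift.
by apply: eq_int => u; rewrite FT_shift// cmod2M cmod2_expiB1.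
Qed.

End fourier.

(** * The linear canonical transform *)

Section trig_bounds.
Variable R : realType.
Implicit Types x y : R.

Lemma sin_cos_MVT x : exists2 c, `|c| <= `|x| & sin x = cos c * x.
Proof.
have pos y : 0 < y -> exists2 c, `|c| <= `|y| & sin y = cos c * y.
  move=> y0; have [|c] := @MVT R sin cos 0 y y0.
    by apply: continuous_subspaceT; exact: continuous_sin.
  rewrite in_itv/= => /andP[c0 cy]; rewrite sin0 !subr0 => ->.
  by exists c => //; rewrite !gtr0_norm// ltW.
have [x0|x0|->] := ltgtP x 0.
- have [|c cx] := pos (- x); first by rewrite oppr_gt0.
  rewrite sinN mulrN => /oppr_inj ->; exists c => //.
  by rewrite -(normrN x).
- exact: pos.
- by exists 0; rewrite ?normr0// sin0 mulr0.
Qed.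

Lemma one_subr_cos y : 2 - 2 * cos y = 4 * sin (y / 2) ^+ 2.
Proof.
rewrite {1}(_ : y = (y / 2) *+ 2) ?cos_mulr2n ?cos2sin2; first by rewrite mulr2n; ring.
by rewrite -mulr_natr; field.
Qed.

Lemma cos_chord_le y : 2 - 2 * cos y <= y ^+ 2.
Proof.
rewrite one_subr_cos; have [c _ ->] := sin_cos_MVT (y / 2).
have -> : 4 * (cos c * (y / 2)) ^+ 2 = cos c ^+ 2 * y ^+ 2 by field.
by rewrite ler_piMl ?sqr_ge0// cos2sin2 lerBlDr lerDl sqr_ge0.
Qed.

(** The chord equals [cos c ^+ 2 * y ^+ 2] with [|c| <= |y / 2| <= 1 / 2]. The upper chord bound at
    [c] then gives [cos c >= 1 / 2], which accounts for the factor 4. *)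
Lemma cos_chord_ge y : `|y| <= 1 -> y ^+ 2 <= 4 * (2 - 2 * cos y).
Proof.
move=> y1; rewrite one_subr_cos; have [c cy ->] := sin_cos_MVT (y / 2).
have -> : 4 * (4 * (cos c * (y / 2)) ^+ 2) = (4 * cos c ^+ 2) * y ^+ 2 by field.
rewrite ler_peMl ?sqr_ge0//.
have c1 : `|c| <= 1.
  by move: cy; rewrite normrM (@ger0_norm _ 2^-1) ?invr_ge0//; lra.
have c2 : c ^+ 2 <= 1 by rewrite -real_normK ?num_real// expr_le1.
have := cos_chord_le c => h.
have ch : 1 / 2 <= cos c by lra.
have : (1 / 2) ^+ 2 <= cos c ^+ 2 by rewrite ler_pXn2r// ?nnegrE; lra.
by rewrite expr_div_n expr1n; lra.
Qed.

End trig_bounds.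

(** * Moments of a nonnegative density *)

Section moments.
Variable R : realType.
Local Notation mu := (@lebesgue_measure R).
Local Notation L1 p := (mu.-integrable setT (EFin \o p)).
Variable p : R -> R.
Hypothesis mp : measurable_fun setT p.
Hypothesis p0 : forall x, 0 <= p x.
Hypothesis pi : (\int[mu]_x (p x)%:E < +oo)%E.
Hypothesis p2i : (\int[mu]_x (x ^+ 2 * p x)%:E < +oo)%E.

Definition moment (k : nat) : R := \int[mu]_x (x ^+ k * p x).

Let i0 : L1 p. Proof. exact: ge0_integrable. Qed.

Let i2 : L1 (fun x => x ^+ 2 * p x).
Proof. by apply: ge0_integrable => //; [meas|nneg]. Qed.

Let i1 : L1 (fun x => x * p x).
Proof.
apply: (@integrable_dom _ _ _ mu _ (fun x : R => 1 * p x + 1 * (x ^+ 2 * p x))).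
- by meas.
- move=> x; rewrite normrM (ger0_norm (p0 x)) !mul1r -{2}[p x]mul1r -mulrDl ler_wpM2r//.
  rewrite -[x ^+ 2]real_normK ?num_real// -subr_ge0.
  rewrite (_ : _ - _ = (`|x| - 1 / 2) ^+ 2 + 3 / 4); last by field.
  by rewrite addr_ge0 ?sqr_ge0// divr_ge0.
- exact: integrable_lin2.
Qed.

Lemma int_quadratic (A B C : R) :
  (\int[mu]_x ((A * x ^+ 2 + B * x + C) * p x)%:E =
   (A * moment 2 + B * moment 1 + C * moment 0)%:E)%E.
Proof.
have E : (fun x => (A * x ^+ 2 + B * x + C) * p x) =
    (fun x => 1 * (A * (x ^+ 2 * p x) + B * (x * p x)) + C * p x).
  by apply/funext => x; ring.
have i3 : L1 (fun x => A * (x ^+ 2 * p x) + B * (x * p x)) by exact: integrable_lin2.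
rewrite integrable_int E; last exact: integrable_lin2.
rewrite Rintegral_lin2// Rintegral_lin2// mul1r /moment; congr EFin.
congr (_ + _ * _ + _ * _).
by apply: eq_Rintegral => x _; rewrite expr0 mul1r.
Qed.

Lemma moment0E : (\int[mu]_x (p x)%:E = (moment 0)%:E)%E.
Proof.
have := int_quadratic 0 0 1; rewrite !mul0r !add0r mul1r => <-.
by apply: eq_int => x; rewrite !mul0r !add0r mul1r.
Qed.

End moments.

(** * Square-integrable functions *)

Section square_integrable.
Variable R : realType.
Local Notation mu := (@lebesgue_measure R).
Local Notation L1 p := (mu.-integrable setT (EFin \o p)).
Local Notation Re := complex.Re.
Local Notation Im := complex.Im.
Implicit Types h k : R -> R[i].

Lemma L2_cmeasurable h : L2 h -> cmeasurable h.
Proof. by move=> [? [? _]]. Qed.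

Lemma L2_fin h : L2 h -> (\int[mu]_x (cmod (h x) ^+ 2)%:E < +oo)%E.
Proof. by move=> [? [? ?]]. Qed.

Lemma L2_integrable h : L2 h -> L1 (fun x => cmod (h x) ^+ 2).
Proof.
move=> hL; apply: ge0_integrable; [|by nneg|exact: L2_fin].
exact/cmeasurable_cmod2/L2_cmeasurable.
Qed.

Lemma cintegrable_dom h (p : R -> R) : cmeasurable h -> L1 p ->
  (forall x, `|Re (h x)| <= p x) -> (forall x, `|Im (h x)| <= p x) -> cintegrable h.
Proof. by move=> [mr mi] pi hr hi; split; apply: integrable_dom pi. Qed.

Lemma norm_mul_le (x y : R) : `|x * y| <= x ^+ 2 + y ^+ 2.
Proof.
rewrite normrM -[x ^+ 2]real_normK ?num_real// -[y ^+ 2]real_normK ?num_real//.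
by have := sqr_ge0 (`|x| - `|y|); have := sqr_ge0 `|x|; have := sqr_ge0 `|y|; nra.
Qed.

Lemma L2_mul_cintegrable h k : L2 h -> L2 k -> cintegrable (fun x => h x * k x).
Proof.
move=> hL kL.
apply: (@cintegrable_dom _ (fun x => 1 * cmod (h x) ^+ 2 + 1 * cmod (k x) ^+ 2)).
- exact: cmeasurableM (L2_cmeasurable hL) (L2_cmeasurable kL).
- exact: integrable_lin2 (L2_integrable hL) (L2_integrable kL).
- move=> x; rewrite ReM !cmod2E !mul1r (le_trans (ler_normB _ _))//.
  by have := norm_mul_le (Re (h x)) (Re (k x)); have := norm_mul_le (Im (h x)) (Im (k x)); lra.
- move=> x; rewrite ImM !cmod2E !mul1r (le_trans (ler_normD _ _))//.
  by have := norm_mul_le (Re (h x)) (Im (k x)); have := norm_mul_le (Im (h x)) (Re (k x)); lra.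
Qed.

Lemma cmod2_rmul (x : R) (z : R[i]) : cmod (x%:C * z) ^+ 2 = x ^+ 2 * cmod z ^+ 2.
Proof. by rewrite cmod2M [cmod x%:C ^+ 2]cmod2E /= expr0n addr0. Qed.

Lemma L2_rmul_fin h : L2 (fun x => x%:C * h x) ->
  (\int[mu]_x (x ^+ 2 * cmod (h x) ^+ 2)%:E < +oo)%E.
Proof. by move=> /L2_fin; under eq_integral do rewrite cmod2_rmul. Qed.

(** With [y = 1 + x ^+ 2], one has [|r| <= y * r ^+ 2 + 2 / y]. The first term is integrable by the
    two L2 hypotheses, and the second is the Poisson kernel with [e = 1] and [l = 1]. So the
    transforms of [h] are absolutely convergent integrals. *)
Lemma L2_cintegrable h : L2 h -> L2 (fun x => x%:C * h x) -> cintegrable h.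
Proof.
move=> hL xhL.
have i0 := L2_integrable hL.
have i2 : L1 (fun x => x ^+ 2 * cmod (h x) ^+ 2).
  by have := L2_integrable xhL; under eq_fun do rewrite cmod2_rmul.
have iK : L1 (fun x : R => 2 * 1 / (1 ^+ 2 + (1 * x) ^+ 2)).
  apply: ge0_integrable.
  - apply: continuous_measurable_fun => x.
    apply: cvgM; first exact: cvg_cst.
    apply: cvgV; first by rewrite gt_eqF// ltr_pwDl ?exprn_gt0 ?sqr_ge0.
    apply: cvgD; first exact: cvg_cst.
    have h1 : 1 * y @[y --> x] --> 1 * x by apply: cvgM; [exact: cvg_cst|exact: cvg_id].
    exact: (cvgM h1 h1).
  - by nneg.
  - by rewrite int_poisson ?ltry// oner_neq0.
pose P x := 1 * (1 * cmod (h x) ^+ 2 + 1 * (x ^+ 2 * cmod (h x) ^+ 2)) +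
   1 * (2 * 1 / (1 ^+ 2 + (1 * x) ^+ 2)) : R.
have iP : L1 P by apply: integrable_lin2 => //; exact: integrable_lin2.
have bd (r s x : R) : r ^+ 2 <= s -> `|r| <= 1 * (1 * s + 1 * (x ^+ 2 * s)) + 1 * (2 * 1 / (1 ^+ 2 + (1 * x) ^+ 2)).
  move=> rs; rewrite !mul1r mulr1 expr1n.
  have x1 : 0 < 1 + x ^+ 2 by rewrite ltr_pwDl// sqr_ge0.
  rewrite (_ : s + x ^+ 2 * s = (1 + x ^+ 2) * s); last ring.
  rewrite -(ler_pM2r x1) mulrDl mulfVK ?gt_eqF//.
  set y := 1 + x ^+ 2 in x1 *.
  have h1 : y * (r ^+ 2) * y <= y * s * y by rewrite ler_pM2r// ler_pM2l.
  apply: (le_trans _ (lerD h1 (lexx 2))).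
  rewrite -[r ^+ 2]real_normK ?num_real// -subr_ge0.
  rewrite (_ : _ - _ = (y * `|r| - 1 / 2) ^+ 2 + 7 / 4); last by field.
  by rewrite addr_ge0 ?sqr_ge0// divr_ge0.
apply: (cintegrable_dom (L2_cmeasurable hL) iP) => x; apply: bd; rewrite cmod2E.
- by rewrite lerDl sqr_ge0.
- by rewrite lerDr sqr_ge0.
Qed.

Lemma L2_shift h r : L2 h -> L2 (fun x => h (x + r)).
Proof.
move=> hL; have [mr mi] := cmeasurable_comp (p := fun x : R => x + r) (L2_cmeasurable hL) ltac:(meas).
split => //; split => //.
rewrite (@ge0_int_shift _ (fun x => cmod (h x) ^+ 2) r); first exact: L2_fin.
  exact/cmeasurable_cmod2/L2_cmeasurable.
by move=> x; exact: cmod2_ge0.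
Qed.

Lemma L2_conj h : L2 h -> L2 (fun x => conjc (h x)).
Proof.
move=> hL; have [mr mi] := cmeasurable_conj (L2_cmeasurable hL).
split => //; split => //; under eq_integral do rewrite cmod2_conj.
exact: L2_fin.
Qed.

End square_integrable.

(** * Reduction to the Fourier transform of a chirped function *)

Section lct.
Variable R : realType.
Local Notation mu := (@lebesgue_measure R).
Local Notation Re := complex.Re.
Local Notation Im := complex.Im.
Variables a b c d : R.
Hypothesis b0 : b != 0.
Implicit Types h : R -> R[i].

(** It absorbs the phase of the kernel that is quadratic in the integration variable; what remains
    is a Fourier kernel at scale [b^-1] and factors independent of that variable. *)
Definition chirp h (x : R) : R[i] := h x * expi (a / (2 * b) * x ^+ 2).

Lemma cmod2_chirp h x : cmod (chirp h x) ^+ 2 = cmod (h x) ^+ 2.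
Proof. by rewrite cmod2M cmod2_expi mulr1. Qed.

Lemma cintegrable_chirp h : cintegrable h -> cintegrable (chirp h).
Proof. by move=> hi; apply: cintegrable_expi => //; meas. Qed.

Lemma cmeasurable_chirp h : cmeasurable h -> cmeasurable (chirp h).
Proof. by move=> mh; apply: cmeasurableM => //; apply: cmeasurable_expi; meas. Qed.

Lemma LCT_FT h u : cintegrable h -> LCT a b c d h u =
  (sqrtc ((2 * pi * b)*i))^-1 * expi (d / (2 * b) * u ^+ 2) * FT b^-1 (chirp h) u.
Proof.
move=> hi; rewrite -cintZ; last first.
  by apply: cintegrable_expi; [exact: cintegrable_chirp|meas].
apply: eq_cint => x; rewrite /LCTkernel /chirp.
rewrite (_ : _ - _ + _ = a / (2 * b) * x ^+ 2 + - (b^-1 * u * x) + d / (2 * b) * u ^+ 2); last ring.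
by rewrite !expiD; ring.
Qed.

(** The modulus of the square root [s] is read off from [s ^+ 2]: the squares of [cmod s ^+ 2] and
    of [2 * pi * |b|] agree, and both numbers are nonnegative. *)
Lemma cmod2_LCT_factor : cmod (sqrtc ((2 * pi * b)*i))^-1 ^+ 2 = (2 * pi * `|b|)^-1.
Proof.
set z := (_ *i)%C; set s := sqrtc z.
have z0 : z != 0.
  rewrite /z eq_complex /= negb_and; apply/orP; right.
  by rewrite !mulf_neq0// gt_eqF// pi_gt0.
have s0 : s != 0 by rewrite sqrtc_eq0.
have bpi : 0 <= 2 * pi * `|b| by rewrite !mulr_ge0// pi_ge0.
have sE : cmod s ^+ 2 = 2 * pi * `|b|.
  apply/eqP; rewrite -(eqrXn2 (n := 2))// ?cmod2_ge0//; apply/eqP.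
  rewrite [LHS]expr2 -cmod2M -expr2 sqr_sqrtc cmod2E /= expr0n add0r.
  by rewrite !exprMn real_normK// num_real.
have : cmod s^-1 ^+ 2 * cmod s ^+ 2 = 1.
  by rewrite -cmod2M mulVf// cmod2E /= expr0n expr1n addr0.
have bne : 2 * pi * `|b| != 0 by rewrite !mulf_neq0// ?normr_eq0// gt_eqF// pi_gt0.
by rewrite sE => h; apply: (mulIf bne); rewrite h mulVf.
Qed.

Lemma cmod2_LCT h u : cintegrable h ->
  cmod (LCT a b c d h u) ^+ 2 = (2 * pi * `|b|)^-1 * cmod (FT b^-1 (chirp h) u) ^+ 2.
Proof.
by move=> hi; rewrite LCT_FT// !cmod2M cmod2_LCT_factor cmod2_expi mulr1.
Qed.

Lemma measurable_cmod2_LCT h : cintegrable h ->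
  measurable_fun setT (fun u => cmod (LCT a b c d h u) ^+ 2).
Proof.
move=> hi; rewrite (_ : (fun u => _) = (fun u => (2 * pi * `|b|)^-1 * cmod (FT b^-1 (chirp h) u) ^+ 2)).
  apply: measurable_funM => //.
  exact/cmeasurable_cmod2/cmeasurable_FT/cintegrable_chirp.
by apply/funext => u; rewrite cmod2_LCT.
Qed.

Let bpi0 : 0 <= (2 * pi * `|b|)^-1.
Proof. by rewrite invr_ge0 !mulr_ge0// pi_ge0. Qed.

(** The normalisation of the kernel cancels the Plancherel constant for [l = b^-1], which makes the
    transform an isometry. *)
Let kapE : (2 * pi * `|b|)^-1 * (2 * pi / `|b^-1|) = 1.
Proof. by rewrite normfV invrK mulVf// !mulf_neq0// ?normr_eq0// gt_eqF// pi_gt0. Qed.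

Lemma LCT_plancherel h : cintegrable h ->
  (\int[mu]_x (cmod (h x) ^+ 2)%:E < +oo)%E ->
  (\int[mu]_u (cmod (LCT a b c d h u) ^+ 2)%:E = \int[mu]_x (cmod (h x) ^+ 2)%:E)%E.
Proof.
move=> hi h2; have ci := cintegrable_chirp hi.
have E : (\int[mu]_x (cmod (chirp h x) ^+ 2)%:E = \int[mu]_x (cmod (h x) ^+ 2)%:E)%E.
  by apply: eq_int => x; rewrite cmod2_chirp.
under eq_integral do rewrite cmod2_LCT//.
rewrite ge0_intZ//; last 2 first.
- exact/cmeasurable_cmod2/cmeasurable_FT.
- by move=> u; exact: cmod2_ge0.
rewrite plancherel ?invr_eq0// E//.
by rewrite muleA -EFinM kapE mul1e.
Qed.

Lemma LCT_plancherel_shift h (th r : R) : cintegrable h ->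
  (\int[mu]_x (cmod (h x) ^+ 2)%:E < +oo)%E ->
  (\int[mu]_u ((2 - 2 * cos (th + u * r / b)) * cmod (LCT a b c d h u) ^+ 2)%:E =
   \int[mu]_x (cmod (expi th * chirp h (x + r)%R - chirp h x) ^+ 2)%:E)%E.
Proof.
move=> hi h2; have ci := cintegrable_chirp hi.
have mh := cmeasurable_cmod2 (cintegrable_measurable hi).
have mc := cintegrable_measurable ci.
have mcr : cmeasurable (fun x : R => chirp h (x + r)).
  by apply: (cmeasurable_comp mc); meas.
have fin : (\int[mu]_x (cmod (expi th * chirp h (x + r)%R - chirp h x) ^+ 2)%:E < +oo)%E.
  apply: (@le_lt_trans _ _ (\int[mu]_x (2 * cmod (h (x + r)%R) ^+ 2 + 2 * cmod (h x) ^+ 2)%:E)%E).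
    apply: ge0_int_le.
    - apply: cmeasurable_cmod2; apply: cmeasurableB => //.
      by apply: cmeasurableM => //; exact: cmeasurable_cst.
    - apply: measurable_funD; apply: measurable_funM => //.
      by apply: (measurableT_comp mh); meas.
    - by move=> x; exact: cmod2_ge0.
    - move=> x; rewrite (le_trans (cmod2_addl _ _))// cmod2M cmod2_expi mul1r cmod2_chirp.
      by rewrite cmod2N cmod2_chirp.
  rewrite ge0_intD; last 4 first.
  - by apply: measurable_funM => //; apply: (measurableT_comp mh); meas.
  - by apply: measurable_funM.
  - by nneg.
  - by nneg.
  rewrite !ge0_intZ//; last 3 first.
  - by nneg.
  - by apply: (measurableT_comp mh); meas.
  - by nneg.
  rewrite (@ge0_int_shift _ (fun x => cmod (h x) ^+ 2) r)//; last by nneg.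
  by rewrite lte_add_pinfty// lte_mul_pinfty.
have bi : b^-1 != 0 by rewrite invr_eq0.
have := plancherel_shift bi ci fin; move/(congr1 (fun w => (2 * pi * `|b|)^-1%:E * w)%E).
rewrite muleA -EFinM kapE mul1e => <-.
have mF := cmeasurable_cmod2 (cmeasurable_FT b^-1 ci).
rewrite -ge0_intZ//.
- apply: eq_int => u; rewrite cmod2_LCT// (_ : b^-1 * u * r = u * r / b); last ring.
  ring.
- by apply: measurable_funM => //; meas.
- by move=> u; rewrite mulr_ge0 ?cmod2_ge0//; have := cos_le1 (th + b^-1 * u * r); lra.
Qed.

(** By [cos_chord_le], a finite second frequency moment makes translation of the chirped function
    Lipschitz in L2. This replaces a bound on the norm of its derivative. *)
Lemma chirp_shift_le h (r : R) : cintegrable h ->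
  (\int[mu]_x (cmod (h x) ^+ 2)%:E < +oo)%E ->
  (\int[mu]_x (cmod (chirp h (x + r)%R - chirp h x) ^+ 2)%:E <=
   ((r / b) ^+ 2)%:E * \int[mu]_u (u ^+ 2 * cmod (LCT a b c d h u) ^+ 2)%:E)%E.
Proof.
move=> hi h2; have mL := measurable_cmod2_LCT hi.
have := LCT_plancherel_shift 0 r hi h2.
under [X in _ = X]eq_integral do rewrite expi0 mul1r.
move=> <-; rewrite -ge0_intZ; [|by meas|by nneg|by nneg].
apply: ge0_int_le; [by meas|by meas| |] => u.
  by rewrite mulr_ge0 ?cmod2_ge0//; have := cos_le1 (0 + u * r / b); lra.
rewrite mulrA ler_wpM2r ?cmod2_ge0//; apply: (le_trans (cos_chord_le _)).
by rewrite le_eqVlt; apply/orP; left; apply/eqP; ring.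
Qed.

End lct.

(** * The short-time transform *)

Section plane_integral.
Variable R : realType.
Local Notation mu := (@lebesgue_measure R).
Local Notation mu2 := (mu \x mu)%E.
Implicit Types F : R -> R -> R.

Lemma measurable_diag_shift F r : measurable_fun setT (fun z : R * R => F z.1 z.2) ->
  measurable_fun setT (fun z : R * R => F (z.1 + r) (z.2 + r)).
Proof.
move=> mF.
apply: (measurableT_comp (f := fun z : R * R => F z.1 z.2) (g := fun z : R * R => (z.1 + r, z.2 + r))) => //.
by meas.
Qed.

Lemma ge0_int2_shift F r : measurable_fun setT (fun z : R * R => F z.1 z.2) ->
  (forall x y, 0 <= F x y) ->
  (\int[mu2]_z (F (z.1 + r)%R (z.2 + r)%R)%:E = \int[mu2]_z (F z.1 z.2)%:E)%E.
Proof.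
move=> mF F0.
have mFr := measurable_diag_shift r mF.
rewrite (@ge0_int_prod _ (fun x y => F (x + r) (y + r)))// ge0_int_prod//.
rewrite -[RHS](@ge0_integral_shift _ (fun x => \int[mu]_y (F x y)%:E)%E r); last 2 first.
- exact: (measurable_int_param mF).
- by move=> x; exact: ge0_int.
apply: eq_integral => x _.
rewrite (@ge0_int_shift _ (F (x + r)) r)//.
exact: (measurable_fun_pair2 (x + r) mF).
Qed.

(** For fixed [x], the map from [t] to [s = x - t] is a reflection followed by a translation. This
    passes from the time lag [t] to the pair [(x, s)] of arguments of signal and window. *)
Lemma ge0_int_difference F : measurable_fun setT (fun z : R * R => F z.1 z.2) ->
  (forall x y, 0 <= F x y) ->
  (\int[mu]_t \int[mu]_x (F x (x - t)%R)%:E = \int[mu2]_z (F z.1 z.2)%:E)%E.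
Proof.
move=> mF F0.
have mFd : measurable_fun setT (fun z : R * R => F z.2 (z.2 - z.1)).
  apply: (measurableT_comp (f := fun z : R * R => F z.1 z.2) (g := fun z : R * R => (z.2, z.2 - z.1))) => //.
  by meas.
rewrite (@ge0_int_swap _ (fun t x => F x (x - t)))// ge0_int_prod//.
apply: eq_integral => x _.
have mx : measurable_fun setT (F x) := measurable_fun_pair2 x mF.
have mx' : measurable_fun setT (fun y : R => F x (y + x)) by apply: (measurableT_comp mx); meas.
rewrite -[RHS](@ge0_int_shift _ (F x) x)//.
rewrite -[RHS](@ge0_int_opp _ (fun y => F x (y + x)))//.
by apply: eq_int => t; rewrite addrC.
Qed.

Lemma ge0_int2_prod (p q : R -> R) : measurable_fun setT p -> measurable_fun setT q ->
  (forall x, 0 <= p x) -> (forall x, 0 <= q x) ->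
  (\int[mu2]_z (p z.1 * q z.2)%:E = \int[mu]_x (p x)%:E * \int[mu]_x (q x)%:E)%E.
Proof.
move=> mp mq p0 q0.
rewrite (@ge0_int_prod R (fun x y => p x * q y)); [|by meas|by nneg].
rewrite -ge0_integralZr//; [|by meas|by move=> x _; rewrite lee_fin|exact: ge0_int].
by apply: eq_integral => x _; rewrite ge0_intZ.
Qed.

End plane_integral.

(** * Energy identities for the short-time transform *)

Section spread.
Variable R : realType.
Local Notation mu := (@lebesgue_measure R).
Local Notation mu2 := (mu \x mu)%E.
Variables (a b c d : R) (f g : R -> R[i]).
Hypothesis b0 : b != 0.
Hypothesis fL : L2 f.
Hypothesis gL : L2 g.
Hypothesis fL1 : L2 (fun t => t%:C * f t).
Hypothesis gL1 : L2 (fun t => t%:C * g t).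

Let af x := cmod (f x) ^+ 2.
Let ag x := cmod (g x) ^+ 2.
Let W (z : R * R) := cmod (STLCT a b c d g f z) ^+ 2.
(** For fixed [t], the short-time transform is the linear canonical transform of [kk t]. *)
Let kk t x := f x * conjc (g (x - t)).

Let mf := L2_cmeasurable fL.
Let mg := L2_cmeasurable gL.
Let maf : measurable_fun setT af. Proof. exact: cmeasurable_cmod2 mf. Qed.
Let mag : measurable_fun setT ag. Proof. exact: cmeasurable_cmod2 mg. Qed.
Let af0 x : 0 <= af x. Proof. exact: sqr_ge0. Qed.
Let ag0 x : 0 <= ag x. Proof. exact: sqr_ge0. Qed.
Let W0 z : 0 <= W z. Proof. exact: sqr_ge0. Qed.

Let mW : measurable_fun setT W.
Proof.
apply: cmeasurable_cmod2.
pose F (w : (R * R) * R) := f w.2 * conjc (g (w.2 - w.1.1)) * LCTkernel a b d w.2 w.1.2.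
have [mr mi] : cmeasurable F.
  apply: cmeasurableM.
    apply: cmeasurableM; first by apply: (cmeasurable_comp mf); meas.
    by apply: cmeasurable_conj; apply: (cmeasurable_comp mg); meas.
  apply: cmeasurableM; first exact: cmeasurable_cst.
  by apply: cmeasurable_expi; meas.
split.
- exact: (@measurable_Rintegral_param R _ _ (fun w => complex.Re (F w)) mr).
- exact: (@measurable_Rintegral_param R _ _ (fun w => complex.Im (F w)) mi).
Qed.

Let kk_int t : cintegrable (kk t).
Proof. exact: (L2_mul_cintegrable fL (L2_conj (L2_shift (- t) gL))). Qed.

Let cmod2_kk t x : cmod (kk t x) ^+ 2 = af x * ag (x - t).
Proof. by rewrite /kk cmod2M cmod2_conj. Qed.

Let mB : measurable_fun setT (fun z : R * R => af z.1 * ag z.2). Proof. by meas. Qed.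

Let fin_f : (\int[mu]_x (af x)%:E < +oo)%E. Proof. exact: L2_fin. Qed.
Let fin_g : (\int[mu]_x (ag x)%:E < +oo)%E. Proof. exact: L2_fin. Qed.

Let fin_f2 : (\int[mu]_x (x ^+ 2 * af x)%:E < +oo)%E.
Proof. exact: L2_rmul_fin fL1. Qed.
Let fin_g2 : (\int[mu]_x (x ^+ 2 * ag x)%:E < +oo)%E.
Proof. exact: L2_rmul_fin gL1. Qed.

Let al := moment af.
Let be := moment ag.

(** The value [sg = -1] serves the time spread, where [t = x - s], and [sg = 1] serves the second
    moments of [x + s]. *)
Let int_quad_joint (sg e : R) :
  (\int[mu2]_z ((z.1 + sg * z.2 + e) ^+ 2 * (af z.1 * ag z.2))%:E =
   (be 0 * (al 2 + 2 * e * al 1 + e ^+ 2 * al 0) + 2 * sg * be 1 * (al 1 + e * al 0)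
     + sg ^+ 2 * be 2 * al 0)%:E)%E.
Proof.
rewrite (@ge0_int_prod _ (fun x s => (x + sg * s + e) ^+ 2 * (af x * ag s))); [|by meas|by nneg].
have E x : (\int[mu]_s ((x + sg * s + e) ^+ 2 * (af x * ag s))%:E =
  ((be 0 * x ^+ 2 + (2 * e * be 0 + 2 * sg * be 1) * x + (e ^+ 2 * be 0 + 2 * sg * e * be 1 + sg ^+ 2 * be 2)) * af x)%:E)%E.
  transitivity (\int[mu]_s (af x * ((x + sg * s + e) ^+ 2 * ag s))%:E)%E.
    by apply: eq_int => s; ring.
  rewrite ge0_intZ; [|by meas|by []|by nneg].
  transitivity ((af x)%:E * \int[mu]_s ((sg ^+ 2 * s ^+ 2 + 2 * sg * (x + e) * s + (x + e) ^+ 2) * ag s)%:E)%E.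
    by congr (_ * _)%E; apply: eq_int => s; ring.
  rewrite int_quadratic// -EFinM; congr EFin; rewrite /be; ring.
under eq_integral do rewrite E.
by rewrite int_quadratic//; congr EFin; rewrite /al; ring.
Qed.

Let alE : (\int[mu]_x (af x)%:E = (al 0)%:E)%E. Proof. exact: moment0E. Qed.
Let beE : (\int[mu]_x (ag x)%:E = (be 0)%:E)%E. Proof. exact: moment0E. Qed.
Let al0 : 0 <= al 0. Proof. by rewrite -lee_fin -alE; exact: ge0_int. Qed.
Let be0 : 0 <= be 0. Proof. by rewrite -lee_fin -beE; exact: ge0_int. Qed.

Let int_joint : (\int[mu2]_z (af z.1 * ag z.2)%:E = (al 0 * be 0)%:E)%E.
Proof. by rewrite ge0_int2_prod// alE beE. Qed.

Let corr t := (\int[mu]_x (af x * ag (x - t)%R)%:E)%E.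

(** The energy of [kk t] is integrable in [t], hence finite for almost every [t]. Plancherel's
    theorem therefore applies to almost every slice. *)
Let corr_int : mu.-integrable setT corr.
Proof.
have mc : measurable_fun setT corr.
  apply: (@measurable_int_param R _ _ (fun z : R * R => af z.2 * ag (z.2 - z.1))); last by nneg.
  by meas.
apply/integrableP; split => //.
have cE t : (`|corr t| = corr t)%E by rewrite gee0_abs//; apply: ge0_int; nneg.
under eq_integral do rewrite cE.
have -> : (\int[mu]_t corr t = (al 0 * be 0)%:E)%E; last exact: ltry.
rewrite -int_joint -(@ge0_int_difference R (fun x s => af x * ag s))//; nneg.
Qed.

(** The weight is constant on each slice of fixed [t], so Plancherel's theorem in [u] on almost
    every slice, followed by the substitution [s = x - t], gives the identity. *)
Let int_W_time (w : R -> R) : measurable_fun setT w -> (forall t, 0 <= w t) ->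
  (\int[mu2]_z (w z.1 * W z)%:E = \int[mu2]_z (w (z.1 - z.2) * (af z.1 * ag z.2))%:E)%E.
Proof.
move=> mw w0.
rewrite -(@ge0_int_difference R (fun x s => w (x - s) * (af x * ag s))); [|by meas|by nneg].
rewrite (_ : (fun z => (w z.1 * W z)%:E) = (fun z : R * R => (w z.1 * W (z.1, z.2))%:E)); last first.
  by apply/funext => -[].
rewrite (@ge0_int_prod R (fun t u => w t * W (t, u))); last 2 first.
- by apply: measurable_funM; [meas|apply: (measurableT_comp mW); meas].
- by nneg.
apply: ge0_ae_eq_integral => //.
- apply: (@measurable_int_param R _ _ (fun z : R * R => w z.1 * W z)); last by nneg.
  by meas.
- apply: (@measurable_int_param R _ _ (fun z : R * R => w (z.2 - (z.2 - z.1)) * (af z.2 * ag (z.2 - z.1)))); last by nneg.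
  by meas.
- by move=> t _; apply: ge0_int; nneg.
- by move=> t _; apply: ge0_int; nneg.
have := integrable_ae measurableT corr_int; apply: filterS => t /(_ Logic.I) ct _.
have {}ct : (corr t < +oo)%E by move: ct; rewrite ge0_fin_numE//; apply: ge0_int; nneg.
have mWt : measurable_fun setT (fun u => W (t, u)) := measurable_fun_pair2 t mW.
rewrite ge0_intZ//.
transitivity ((w t)%:E * corr t)%E.
  congr (_ * _)%E.
  have kkE : (\int[mu]_x (cmod (kk t x) ^+ 2)%:E = corr t)%E.
    by apply: eq_int => x; rewrite cmod2_kk.
  by rewrite -kkE -(LCT_plancherel a c d b0 (kk_int t)) ?kkE.
rewrite -ge0_intZ//; [|by meas|by nneg].
by apply: eq_int => x; rewrite subKr.
Qed.

Let G := chirp a b f.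
Let mG : cmeasurable G. Proof. exact: cmeasurable_chirp. Qed.

(** The translation is along the diagonal because this preserves [x - s = t]: on the slice of fixed
    [t], the increment is that of the chirped [kk t]. *)
Let D th r x s := cmod (expi th * (G (x + r) * conjc (g (s + r))) - G x * conjc (g s)) ^+ 2.

Let mD th r : measurable_fun setT (fun z : R * R => D th r z.1 z.2).
Proof.
apply: cmeasurable_cmod2; apply: cmeasurableB.
  apply: cmeasurableM; first exact: cmeasurable_cst.
  apply: cmeasurableM; first by apply: (cmeasurable_comp mG); meas.
  by apply: cmeasurable_conj; apply: (cmeasurable_comp mg); meas.
apply: cmeasurableM; first by apply: (cmeasurable_comp mG); meas.
by apply: cmeasurable_conj; apply: (cmeasurable_comp mg); meas.
Qed.

Let chord_ge0 y : 0 <= 2 - 2 * cos y :> R.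
Proof. by have := cos_le1 y; lra. Qed.

Let int_W_freq th r :
  (\int[mu2]_z ((2 - 2 * cos (th + z.2 * r / b)) * W z)%:E =
   \int[mu2]_z (D th r z.1 z.2)%:E)%E.
Proof.
rewrite -(@ge0_int_difference R (D th r)); [|exact: mD|by nneg].
rewrite (_ : (fun z => _%:E) = (fun z : R * R => ((2 - 2 * cos (th + z.2 * r / b)) * W (z.1, z.2))%:E)); last first.
  by apply/funext => -[].
have mcW : measurable_fun setT (fun z : R * R => (2 - 2 * cos (th + z.2 * r / b)) * W z).
  by meas.
have mcW' : measurable_fun setT (fun z : R * R => (2 - 2 * cos (th + z.2 * r / b)) * W (z.1, z.2)).
  by apply: measurable_funM; [meas|apply: (measurableT_comp mW); meas].
rewrite (@ge0_int_prod R (fun t u => (2 - 2 * cos (th + u * r / b)) * W (t, u))); [|exact: mcW'|by move=> t u; apply: mulr_ge0].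
apply: ge0_ae_eq_integral => //.
- apply: (@measurable_int_param R _ _ (fun z : R * R => (2 - 2 * cos (th + z.2 * r / b)) * W z)) => //.
  by move=> z; apply: mulr_ge0.
- apply: (@measurable_int_param R _ _ (fun z : R * R => D th r z.2 (z.2 - z.1))); last by nneg.
  apply: (measurableT_comp (f := fun z : R * R => D th r z.1 z.2) (g := fun z : R * R => (z.2, z.2 - z.1))); first exact: mD.
  by meas.
- by move=> t _; apply: ge0_int => u; apply: mulr_ge0.
- by move=> t _; apply: ge0_int; nneg.
have := integrable_ae measurableT corr_int; apply: filterS => t /(_ Logic.I) ct _.
have {}ct : (corr t < +oo)%E by move: ct; rewrite ge0_fin_numE//; apply: ge0_int; nneg.
have kkE : (\int[mu]_x (cmod (kk t x) ^+ 2)%:E = corr t)%E.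
  by apply: eq_int => x; rewrite cmod2_kk.
have kk2 : (\int[mu]_x (cmod (kk t x) ^+ 2)%:E < +oo)%E by rewrite kkE.
apply: (etrans (LCT_plancherel_shift a c d b0 th r (kk_int t) kk2)).
apply: eq_int => x; rewrite /D; congr (cmod _ ^+ 2).
have chE y : chirp a b (kk t) y = G y * conjc (g (y - t)).
  by rewrite /G /chirp /kk; ring.
by rewrite !chE addrAC.
Qed.

(** * Finiteness of the second frequency moment *)

Hypothesis fLu : L2 (fun u => u%:C * LCT a b c d f u).
Hypothesis gLu : L2 (fun u => u%:C * LCT a b c d g u).

Let fI : cintegrable f := L2_cintegrable fL fL1.
Let gI : cintegrable g := L2_cintegrable gL gL1.

Let UF := \int[mu]_u (u ^+ 2 * cmod (LCT a b c d f u) ^+ 2).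
Let UG := \int[mu]_u (u ^+ 2 * cmod (LCT a b c d g u) ^+ 2).

Let UFE : (\int[mu]_u (u ^+ 2 * cmod (LCT a b c d f u) ^+ 2)%:E = UF%:E)%E.
Proof.
by apply: ge0_int_fin; [nneg|exact: L2_rmul_fin fLu].
Qed.

Let UGE : (\int[mu]_u (u ^+ 2 * cmod (LCT a b c d g u) ^+ 2)%:E = UG%:E)%E.
Proof.
by apply: ge0_int_fin; [nneg|exact: L2_rmul_fin gLu].
Qed.

Let th := a / (2 * b).

(* g is its chirped version times a unimodular Lipschitz factor, so its
   translation modulus is linear too. *)
Let g_shift_pointwise r x : 0 < r -> r <= `|b| ->
  cmod (g (x + r) - g x) ^+ 2 <=
  2 * cmod (chirp a b g (x + r) - chirp a b g x) ^+ 2 +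
  2 * th ^+ 2 * r ^+ 2 * ((8 * x ^+ 2 + 2 * b ^+ 2) * ag x).
Proof.
move=> r0 rb.
have gE y : g y = expi (- (th * y ^+ 2)) * chirp a b g y.
  by rewrite /chirp mulrCA -expiD addNr expi0 mulr1.
rewrite (gE (x + r)) (gE x).
set ga := chirp a b g.
have -> : expi (- (th * (x + r) ^+ 2)) = expi (- (th * x ^+ 2)) * expi (- (th * (2 * x * r + r ^+ 2))).
  by rewrite -expiD; congr expi; ring.
set e1 := expi (- (th * x ^+ 2)); set y := - (th * _); set e2 := expi y.
rewrite (_ : _ - _ = e1 * e2 * (ga (x + r) - ga x) + e1 * ((e2 - 1) * ga x)); last ring.
rewrite (le_trans (cmod2_addl _ _))// (cmod2M (e1 * e2)) (cmod2M e1 e2) (cmod2M e1 (_ * _)).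
rewrite (cmod2M (e2 - 1)) !cmod2_expi !mul1r lerD2l cmod2_expiB1 cmod2_chirp.
have hy : 2 - 2 * cos y <= th ^+ 2 * r ^+ 2 * (8 * x ^+ 2 + 2 * b ^+ 2).
  apply: (le_trans (cos_chord_le _)).
  rewrite (_ : y ^+ 2 = th ^+ 2 * r ^+ 2 * (2 * x + r) ^+ 2); last by rewrite /y; ring.
  apply: ler_wpM2l; first by nneg.
  (* Capping [r] by [|b|] makes the constant independent of [r], so that the whole bound is of order
     [r ^+ 2]. *)
  have rb2 : r ^+ 2 <= b ^+ 2.
    by rewrite -[b ^+ 2]real_normK ?num_real// ler_pXn2r// nnegrE ltW.
  rewrite -subr_ge0 (_ : _ - _ = (2 * x - r) ^+ 2 + 2 * (b ^+ 2 - r ^+ 2)); last ring.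
  by rewrite addr_ge0 ?sqr_ge0// mulr_ge0// subr_ge0.
rewrite (_ : 2 * th ^+ 2 * r ^+ 2 * _ = 2 * (th ^+ 2 * r ^+ 2 * (8 * x ^+ 2 + 2 * b ^+ 2) * ag x)); last ring.
by apply: ler_wpM2l => //; apply: ler_wpM2r; [exact: cmod2_ge0|exact: hy].
Qed.

Let CG := 2 * (UG / b ^+ 2) + 2 * th ^+ 2 * (8 * be 2 + 2 * b ^+ 2 * be 0).

Let mdiff (h : R -> R[i]) r : cmeasurable h -> measurable_fun setT (fun x : R => cmod (h (x + r) - h x) ^+ 2).
Proof.
move=> mh; apply: cmeasurable_cmod2; apply: cmeasurableB => //.
by apply: (cmeasurable_comp mh); meas.
Qed.

Let g_shift_le r : 0 < r -> r <= `|b| ->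
  (\int[mu]_x (cmod (g (x + r)%R - g x) ^+ 2)%:E <= (r ^+ 2 * CG)%:E)%E.
Proof.
move=> r0 rb.
have mga := mdiff r (cmeasurable_chirp a b mg).
have mgd := mdiff r mg.
apply: (le_trans (ge0_int_le mu mgd _ _ (fun x => g_shift_pointwise x r0 rb))); [by meas|by nneg|].
rewrite ge0_intD; [|by meas|by meas|by nneg|by nneg].
rewrite ge0_intZ; [|by meas|by []|by nneg].
rewrite ge0_intZ; [|by meas|by nneg|by nneg].
have -> : (\int[mu]_x ((8 * x ^+ 2 + 2 * b ^+ 2) * ag x)%:E = (8 * be 2 + 2 * b ^+ 2 * be 0)%:E)%E.
  have := int_quadratic mag ag0 fin_g fin_g2 8 0 (2 * b ^+ 2); rewrite mul0r addr0 => <-.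
  by apply: eq_int => x; rewrite mul0r addr0.
have := chirp_shift_le a c d b0 r gI fin_g; rewrite UGE => h.
apply: (@le_trans _ _ (2%:E * (((r / b) ^+ 2)%:E * UG%:E) + (2 * th ^+ 2 * r ^+ 2)%:E * (8 * be 2 + 2 * b ^+ 2 * be 0)%:E)%E).
  by apply: leeD => //; rewrite lee_pmul2l.
rewrite -!EFinM -EFinD lee_fin /CG le_eqVlt; apply/orP; left; apply/eqP.
by field.
Qed.

Let CS := 2 * (UF / b ^+ 2 * be 0) + 2 * (al 0 * CG).

(** A discrete Leibniz rule: the increment of a product splits into an increment of [G] times the
    shifted window and [G] times an increment of the window. Each factor increment is of order [r]
    in L2. *)
Let D_le r : 0 < r -> r <= `|b| ->
  (\int[mu2]_z (D 0 r z.1 z.2)%:E <= (r ^+ 2 * CS)%:E)%E.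
Proof.
move=> r0 rb.
have mGd := mdiff r mG.
have mgd := mdiff r mg.
have magr : measurable_fun setT (fun s : R => ag (s + r)) by meas.
have mGd2 : measurable_fun setT (fun z : R * R => cmod (G (z.1 + r) - G z.1) ^+ 2).
  exact: (measurableT_comp mGd measurable_fst).
have mgd2 : measurable_fun setT (fun z : R * R => cmod (g (z.2 + r) - g z.2) ^+ 2).
  exact: (measurableT_comp mgd measurable_snd).
apply: (@le_trans _ _ (\int[mu2]_z (2 * (cmod (G (z.1 + r)%R - G z.1) ^+ 2 * ag (z.2 + r)%R) +
   2 * (af z.1 * cmod (g (z.2 + r)%R - g z.2) ^+ 2))%:E)%E).
  apply: ge0_int_le.
  - exact: mD.
  - by meas.
  - by nneg.
  move=> [x s] /=; rewrite /D expi0 mul1r.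
  rewrite (_ : _ - _ = (G (x + r) - G x) * conjc (g (s + r)) + G x * conjc (g (s + r) - g s)); last first.
    by rewrite rmorphB; ring.
  rewrite (le_trans (cmod2_addl _ _))//.
  by rewrite (cmod2M (G (x + r) - G x)) (cmod2M (G x)) !cmod2_conj cmod2_chirp.
rewrite ge0_intD; [|by meas|by meas|by nneg|by nneg].
rewrite ge0_intZ; [|by meas|by []|by nneg].
rewrite ge0_intZ; [|by meas|by []|by nneg].
rewrite (@ge0_int2_prod R (fun x => cmod (G (x + r) - G x) ^+ 2) (fun s => ag (s + r))); [|by []|by []|by nneg|by nneg].
rewrite (@ge0_int2_prod R af (fun s => cmod (g (s + r) - g s) ^+ 2)); [|by []|by []|by nneg|by nneg].
rewrite (ge0_int_shift r mag ag0) alE beE.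
have h1 := chirp_shift_le a c d b0 r fI fin_f; rewrite UFE in h1.
have h2 := g_shift_le r0 rb.
apply: (@le_trans _ _ (2%:E * (((r / b) ^+ 2)%:E * UF%:E * (be 0)%:E) + 2%:E * ((al 0)%:E * (r ^+ 2 * CG)%:E))%E).
  by apply: leeD; rewrite lee_pmul2l//; [exact: lee_wpmul2r|exact: lee_wpmul2l].
rewrite -!EFinM -EFinD lee_fin /CS le_eqVlt; apply/orP; left; apply/eqP.
by field.
Qed.

(** On the truncation [|u| <= n + 1], [u ^+ 2] is dominated by a multiple of the chord, whose
    integral is controlled by [D_le]. The resulting bound [4 * b ^+ 2 * CS] is free of [n], and
    monotone convergence concludes. *)
Let int_u2W_fin : (\int[mu2]_z (z.2 ^+ 2 * W z)%:E < +oo)%E.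
Proof.
pose F n (z : R * R) := z.2 ^+ 2 * \1_(`[(- n.+1%:R), n.+1%:R]%classic) z.2 * W z : R.
have mF n : measurable_fun setT (F n).
  apply: measurable_funM => //; apply: measurable_funM; first by meas.
  have m1 : measurable_fun setT (\1_(`[(- n.+1%:R), n.+1%:R]%classic) : R -> R).
    by apply: measurable_indic; exact: measurable_itv.
  by apply: (measurableT_comp m1); meas.
have F0 n z : 0 <= F n z.
  by apply: mulr_ge0 => //; apply: mulr_ge0 => //; exact: sqr_ge0.
have Fnd z n n' : (n <= n')%N -> F n z <= F n' z.
  move=> nn'; rewrite /F ler_wpM2r// ler_wpM2l ?sqr_ge0// !indicE ler_nat.
  case: (boolP (z.2 \in _)) => //; rewrite inE/= in_itv/= => /andP[h1 h2].
  rewrite mem_set//= in_itv/=; have : n.+1%:R <= n'.+1%:R :> R by rewrite ler_nat.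
  by lra.
apply: (@le_lt_trans _ _ (4 * b ^+ 2 * CS)%:E); last exact: ltry.
have -> : (\int[mu2]_z (z.2 ^+ 2 * W z)%:E = \int[mu2]_z limn (fun n => (F n z)%:E))%E.
  apply: eq_integral => z _; apply/esym/cvg_lim => //; apply: cvg_near_cst.
  near=> n; rewrite /F indicE mem_set ?mulr1//= in_itv/= -ler_norml.
  by apply: (@le_trans _ _ n%:R); [near: n; exact: nbhs_infty_ger|rewrite ler_nat].
rewrite monotone_convergence//; first last.
- by move=> z _ n n' nn'; rewrite lee_fin Fnd.
- by move=> n z _; rewrite lee_fin.
- by move=> n; apply/measurable_EFinP; exact: mF.
apply: lime_le.
  apply: ereal_nondecreasing_is_cvgn => n n' nn'.
  by apply: ge0_int_le; [exact: mF|exact: mF|exact: F0|move=> z; exact: Fnd].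
near=> n.
(* This step gives [|u * r / b| <= 1] on the truncation, as [cos_chord_ge] requires, and the factor
   [r ^+ 2] from [D_le] cancels [(n + 1) ^+ 2]. *)
pose r := `|b| / n.+1%:R.
have b'0 : 0 < `|b| by rewrite normr_gt0.
have n0 : 0 < n.+1%:R :> R by rewrite ltr0n.
have r0 : 0 < r by rewrite divr_gt0.
have rb : r <= `|b| by rewrite ler_pdivrMr// ler_peMr ?ler1n// ltW.
have mc : measurable_fun setT (fun z : R * R => (2 - 2 * cos (0 + z.2 * r / b)) * W z) by meas.
have cW0 (z : R * R) : 0 <= (2 - 2 * cos (0 + z.2 * r / b)) * W z by apply: mulr_ge0.
apply: (@le_trans _ _ (\int[mu2]_z (4 * n.+1%:R ^+ 2 * ((2 - 2 * cos (0 + z.2 * r / b)) * W z))%:E)%E).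
  apply: ge0_int_le; [exact: mF|by apply: measurable_funM => //; exact: mc|exact: F0|move=> z].
  rewrite /F [leRHS]mulrA; apply: ler_wpM2r => //; rewrite indicE.
  case: (boolP (z.2 \in _)) => [|_]; last first.
    by rewrite mulr0; apply: mulr_ge0 => //; nneg.
  rewrite inE/= in_itv/= -ler_norml mulr1 => zn.
  have zr : `|z.2 * r / b| <= 1.
    rewrite !normrM !normfV normr_id (gtr0_norm n0).
    rewrite (_ : _ * _ * _ = `|z.2| / n.+1%:R); last by field; rewrite !gt_eqF.
    by rewrite ler_pdivrMr// mul1r.
  have := cos_chord_ge zr; rewrite add0r.
  rewrite (_ : (z.2 * r / b) ^+ 2 = z.2 ^+ 2 / n.+1%:R ^+ 2); last first.
    rewrite /r !exprMn !exprVn real_normK ?num_real//.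
    by field; rewrite b0 gt_eqF.
  by rewrite ler_pdivrMr ?exprn_gt0// mulrAC.
rewrite ge0_intZ; [|by []|by nneg|by []].
rewrite int_W_freq.
apply: (@le_trans _ _ ((4 * n.+1%:R ^+ 2)%:E * (r ^+ 2 * CS)%:E)%E).
  by rewrite lee_pmul2l ?lte_fin ?mulr_gt0 ?exprn_gt0//; exact: D_le.
rewrite -EFinM lee_fin le_eqVlt; apply/orP; left; apply/eqP.
by rewrite /r exprMn exprVn real_normK ?num_real//; field; rewrite gt_eqF.
Unshelve. all: by end_near. Qed.

Let int_W : (\int[mu2]_z (W z)%:E = (al 0 * be 0)%:E)%E.
Proof.
have := @int_W_time (cst 1) (measurable_cst _) (fun=> ler01).
under eq_integral do rewrite mul1r.
move=> ->; rewrite -int_joint.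
by apply: eq_int => z; rewrite mul1r.
Qed.

Let int_freq_fin u0 : (\int[mu2]_z ((z.2 - u0) ^+ 2 * W z)%:E < +oo)%E.
Proof.
apply: (@le_lt_trans _ _ (\int[mu2]_z (2 * (z.2 ^+ 2 * W z) + 2 * u0 ^+ 2 * W z)%:E)%E).
  apply: ge0_int_le; [by meas|by meas|by nneg|move=> z].
  rewrite (_ : _ + _ = (2 * z.2 ^+ 2 + 2 * u0 ^+ 2) * W z); last ring.
  apply: ler_wpM2r => //.
  rewrite -subr_ge0 (_ : _ - _ = (z.2 + u0) ^+ 2); last ring.
  exact: sqr_ge0.
rewrite ge0_intD; [|by meas|by meas|by nneg|by nneg].
rewrite ge0_intZ; [|by meas|by []|by nneg].
rewrite ge0_intZ; [|by []|by nneg|by []].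
apply: lte_add_pinfty; last by rewrite int_W -EFinM ltry.
by apply: lte_mul_pinfty => //; exact: int_u2W_fin.
Qed.

(** * The uncertainty inequality by finite increments *)

Hypothesis al_gt0 : 0 < al 0.
Hypothesis be_gt0 : 0 < be 0.

Let N := al 0 * be 0.
(** [N] times the sum of the variances of the normalised densities [af / al 0] and [ag / be 0]. *)
Let NV := be 0 * al 2 + al 0 * be 2 - al 1 ^+ 2 * be 0 / al 0 - be 1 ^+ 2 * al 0 / be 0.
Let Q u0 := \int[mu2]_z ((z.2 - u0) ^+ 2 * W z).

Let QE u0 : (\int[mu2]_z ((z.2 - u0) ^+ 2 * W z)%:E = (Q u0)%:E)%E.
Proof. by apply: ge0_int_fin; [nneg|exact: int_freq_fin]. Qed.

(** The mean of [x + s] under the normalised joint density; second moments centred there have no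
    term linear in [y]. *)
Let cen := al 1 / al 0 + be 1 / be 0.

Let int_sum_quad y :
  (\int[mu2]_z ((z.1 + z.2 + (y - cen)) ^+ 2 * (af z.1 * ag z.2))%:E = (NV + N * y ^+ 2)%:E)%E.
Proof.
have := int_quad_joint 1 (y - cen).
under eq_integral do rewrite mul1r.
move=> ->; congr EFin; rewrite /NV /N /cen.
by field; rewrite !gt_eqF.
Qed.

(** Translating the density moves the mean of [x + s] by [- 2 * r], one [r] for each variable. *)
Let int_sum_quad_shift r y :
  (\int[mu2]_z ((z.1 + z.2 + (y - cen)) ^+ 2 * (af (z.1 + r)%R * ag (z.2 + r)%R))%:E =
   (NV + N * (y - 2 * r) ^+ 2)%:E)%E.
Proof.
rewrite -int_sum_quad.
rewrite -(@ge0_int2_shift R (fun x s => (x + s + (y - 2 * r - cen)) ^+ 2 * (af x * ag s)) r); [|by meas|by nneg].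
by apply: eq_int => z; congr (_ ^+ 2 * _); ring.
Qed.

Let int_joint_shift r : (\int[mu2]_z (af (z.1 + r)%R * ag (z.2 + r)%R)%:E = N%:E)%E.
Proof.
by rewrite (@ge0_int2_shift R (fun x s => af x * ag s) r)//; nneg.
Qed.

(* Weighted Cauchy-Schwarz for a translation increment:
   w (|z2|^2 - |z1|^2) = w <z2 - z1, z2 + z1>. *)
Let increment_le (z1 z2 : R[i]) (w lam : R) : 0 < lam ->
  (w + 1) ^+ 2 * cmod z2 ^+ 2 + (w - 1) ^+ 2 * cmod z1 ^+ 2 <=
  (1 + 2 / lam) * (w ^+ 2 * cmod z2 ^+ 2) + cmod z2 ^+ 2 +
  ((1 + 2 / lam) * (w ^+ 2 * cmod z1 ^+ 2) + cmod z1 ^+ 2) +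
  lam * cmod (z1 - z2) ^+ 2.
Proof.
move=> lam0; case: z1 z2 => [x1 y1] [x2 y2]; rewrite !cmod2E /= -subr_ge0.
rewrite (_ : _ - _ = lam^-1 * ((lam * (x1 - x2) + w * (x1 + x2)) ^+ 2 +
   (lam * (y1 - y2) + w * (y1 + y2)) ^+ 2 + w ^+ 2 * ((x1 - x2) ^+ 2 + (y1 - y2) ^+ 2))).
  by rewrite mulr_ge0 ?invr_ge0 ?(ltW lam0)// !addr_ge0 ?sqr_ge0// mulr_ge0 ?addr_ge0 ?sqr_ge0.
by field; rewrite gt_eqF.
Qed.

(** Integrating [increment_le], the left side exceeds the terms it shares with the right side by
    [4 * N * r], the effect of the displaced mean. The squares of [w + 1] and [w - 1] keep every
    integrand nonnegative. Dividing by [r] gives the bound. *)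
Let increment_bound u0 r kap : 0 < r -> 0 < kap ->
  4 * N <= kap * (Q u0 / b ^+ 2) + 4 * (NV + N * r ^+ 2) / kap.
Proof.
move=> r0 kap0.
(* With this phase, the argument of the chord becomes [(u - u0) * r / b]. *)
pose ph := - (u0 * r / b).
(* The increment term is [lam] times order [r ^+ 2], and the variance term is of order [1 / lam].
   This choice makes both proportional to [r], like the left side. *)
pose lam := kap / r.
have lam0 : 0 < lam by rewrite divr_gt0.
have Dle : (\int[mu2]_z (D ph r z.1 z.2)%:E <= ((r / b) ^+ 2 * Q u0)%:E)%E.
  rewrite -int_W_freq EFinM -QE -ge0_intZ; [|by meas|by nneg|by nneg].
  apply: ge0_int_le; [by meas|by meas|by move=> z; apply: mulr_ge0|move=> z].
  rewrite [leRHS]mulrA ler_wpM2r//; apply: (le_trans (cos_chord_le _)).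
  rewrite le_eqVlt; apply/orP; left; apply/eqP; rewrite /ph; ring.
(* The origin is the midpoint of the two means: [w] has mean [r] under the original density and
   [- r] under the translated one, so its second moment is [NV + N * r ^+ 2] under both. *)
pose w (z : R * R) := z.1 + z.2 + (r - cen).
pose A (z : R * R) := af (z.1 + r) * ag (z.2 + r).
pose B (z : R * R) := af z.1 * ag z.2.
have mw : measurable_fun setT w by rewrite /w; meas.
have mA : measurable_fun setT A by rewrite /A; meas.
have A0 z : 0 <= A z by rewrite /A; nneg.
have B0 z : 0 <= B z by rewrite /B; nneg.
have mDz := mD ph r.
have D0 z : 0 <= D ph r z.1 z.2 by rewrite /D; exact: cmod2_ge0.
have l1 : 0 <= 1 + 2 / lam by nneg.
have ptw z : (w z + 1) ^+ 2 * B z + (w z - 1) ^+ 2 * A z <=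
   (1 + 2 / lam) * (w z ^+ 2 * B z) + B z + ((1 + 2 / lam) * (w z ^+ 2 * A z) + A z) + lam * D ph r z.1 z.2.
  have := increment_le (expi ph * (G (z.1 + r) * conjc (g (z.2 + r)))) (G z.1 * conjc (g z.2)) (w z) lam0.
  have -> : cmod (expi ph * (G (z.1 + r) * conjc (g (z.2 + r)))) ^+ 2 = A z.
    by rewrite (cmod2M (expi ph)) cmod2_expi mul1r cmod2M cmod2_conj cmod2_chirp.
  have -> : cmod (G z.1 * conjc (g z.2)) ^+ 2 = B z.
    by rewrite cmod2M cmod2_conj cmod2_chirp.
  exact.
have := @ge0_int_le _ _ _ mu2 _ _ _ _ _ ptw.
have i1 : (\int[mu2]_z ((w z + 1) ^+ 2 * B z)%:E = (NV + N * (r + 1) ^+ 2)%:E)%E.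
  by rewrite -int_sum_quad; apply: eq_int => z; congr (_ ^+ 2 * _); rewrite /w; ring.
have i2 : (\int[mu2]_z ((w z - 1) ^+ 2 * A z)%:E = (NV + N * (r - 1 - 2 * r) ^+ 2)%:E)%E.
  by rewrite -int_sum_quad_shift; apply: eq_int => z; congr (_ ^+ 2 * _); rewrite /w; ring.
have i3 : (\int[mu2]_z (w z ^+ 2 * B z)%:E = (NV + N * r ^+ 2)%:E)%E by rewrite -int_sum_quad.
have i4 : (\int[mu2]_z (w z ^+ 2 * A z)%:E = (NV + N * (r - 2 * r) ^+ 2)%:E)%E by rewrite -int_sum_quad_shift.
have i5 : (\int[mu2]_z (B z)%:E = N%:E)%E by exact: int_joint.
have i6 : (\int[mu2]_z (A z)%:E = N%:E)%E by exact: int_joint_shift.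
have mB' : measurable_fun setT B by exact: mB.
rewrite ge0_intD; [|by meas|by meas|by nneg|by nneg].
rewrite ge0_intD; [|by meas|by meas|by nneg|by nneg].
rewrite ge0_intD; [|by meas|by meas|by nneg|by nneg].
rewrite ge0_intD; [|by meas|by meas|by nneg|by nneg].
rewrite ge0_intD; [|by meas|by meas|by nneg|by nneg].
rewrite ge0_intZ; [|by meas|by []|by nneg].
rewrite ge0_intZ; [|by meas|by []|by nneg].
rewrite ge0_intZ; [|by []|by nneg|by []].
rewrite i1 i2 i3 i4 i5 i6.
have mL : measurable_fun setT (fun z : R * R => (w z + 1) ^+ 2 * B z + (w z - 1) ^+ 2 * A z) by meas.
have mR : measurable_fun setT (fun z : R * R => (1 + 2 / lam) * (w z ^+ 2 * B z) + B z +
    ((1 + 2 / lam) * (w z ^+ 2 * A z) + A z) + lam * D ph r z.1 z.2).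
  by meas.
move=> /(_ mL mR ltac:(by nneg)) H.
have {}H : ((NV + N * (r + 1) ^+ 2)%:E + (NV + N * (r - 1 - 2 * r) ^+ 2)%:E <=
  ((1 + 2 / lam) * (NV + N * r ^+ 2) + N + ((1 + 2 / lam) * (NV + N * (r - 2 * r) ^+ 2) + N) + lam * ((r / b) ^+ 2 * Q u0))%:E)%E.
  apply: (le_trans H); rewrite [leRHS]EFinD [in leRHS]EFinM; apply: leeD => //.
  by rewrite lee_pmul2l.
move: H; rewrite -EFinD lee_fin -subr_ge0.
rewrite (_ : _ - _ = r * (kap * (Q u0 / b ^+ 2) + 4 * (NV + N * r ^+ 2) / kap - 4 * N)); last first.
  by rewrite /lam; field; rewrite b0 !gt_eqF.
by rewrite pmulr_rge0// subr_ge0.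
Qed.

Let increment_bound_lim u0 kap : 0 < kap -> 4 * N <= kap * (Q u0 / b ^+ 2) + 4 * NV / kap.
Proof.
move=> kap0; apply/ler_addgt0Pr => e e0.
have N0 : 0 < N by rewrite mulr_gt0.
(* From [r <= 1] follows [r ^+ 2 <= r], and the second bound then makes the remainder
   [4 * N * r ^+ 2 / kap] at most [e]. *)
pose r := Num.min 1 (e * kap / (4 * N)).
have r0 : 0 < r by rewrite lt_min ltr01 divr_gt0 ?mulr_gt0.
have r1 : r <= 1 by rewrite ge_min lexx.
have re : r <= e * kap / (4 * N) by rewrite ge_min lexx orbT.
apply: (le_trans (increment_bound u0 r0 kap0)); rewrite -[leRHS]addrA; apply: lerD => //.
rewrite mulrDr mulrDl; apply: lerD => //.
have : r ^+ 2 <= e * kap / (4 * N).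
  by apply: le_trans re; rewrite expr2 ler_piMr// ltW.
rewrite ler_pdivlMr ?mulr_gt0// => h.
by rewrite ler_pdivrMr//; move: h; rewrite mulrC mulrA.
Qed.

(** The joint density is a product, so [x - s] has the same variance as [x + s]. Hence the time
    spread about any [m] is at least [NV], with the squared offset of [m] from the mean as the
    excess. *)
Let int_time m : (\int[mu2]_z ((z.1 - m) ^+ 2 * W z)%:E =
  (NV + N * (m - (al 1 / al 0 - be 1 / be 0)) ^+ 2)%:E)%E.
Proof.
rewrite (@int_W_time (fun t => (t - m) ^+ 2)); [|by meas|by nneg].
transitivity (\int[mu2]_z ((z.1 + (-1) * z.2 + (- m)) ^+ 2 * (af z.1 * ag z.2))%:E)%E.
  by apply: eq_int => z; congr (_ ^+ 2 * _); ring.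
rewrite int_quad_joint; congr EFin; rewrite /NV /N.
by field; rewrite !gt_eqF.
Qed.

Lemma spread_product m u0 : b ^+ 2 * Snorm2 a b c d g f ^+ 2 <=
  dint (fun z => (z.1 - m) ^+ 2 * cmod (STLCT a b c d g f z) ^+ 2) *
  dint (fun z => (z.2 - u0) ^+ 2 * cmod (STLCT a b c d g f z) ^+ 2)
  /\ 0 < Snorm2 a b c d g f.
Proof.
have NE : Snorm2 a b c d g f = N by rewrite /Snorm2 /dint /Rintegral int_W.
have N0 : 0 < N by rewrite mulr_gt0.
rewrite NE; split => //.
rewrite (_ : dint (fun z : R * R => (z.2 - u0) ^+ 2 * cmod (STLCT a b c d g f z) ^+ 2) = Q u0); last by [].
set T := dint _.
have TE : T = NV + N * (m - (al 1 / al 0 - be 1 / be 0)) ^+ 2 by rewrite /T /dint /Rintegral int_time.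
have T0 : 0 <= T.
  by apply: Rintegral_ge0 => z _; rewrite mulr_ge0// sqr_ge0.
have Q0 : 0 <= Q u0.
  by apply: Rintegral_ge0 => z _; rewrite mulr_ge0// sqr_ge0.
have b2 : 0 < b ^+ 2 by rewrite exprn_even_gt0.
have k kap : 0 < kap -> 4 * N <= kap * (Q u0 / b ^+ 2) + 4 * T / kap.
  move=> kap0; apply: (le_trans (increment_bound_lim u0 kap0)); rewrite lerD2l ler_pM2r ?invr_gt0// ler_pM2l//.
  by rewrite TE lerDl mulr_ge0 ?sqr_ge0// ltW.
(* If [Q u0] vanished, the bound would read [4 * N <= 4 * T / kap] for every positive [kap];
   [kap = 2 * T / N], or [kap = 1] when [T = 0], contradicts [0 < N]. *)
have [Q00|Qp] := eqVneq (Q u0) 0.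
  exfalso; have [T00|Tp] := eqVneq T 0.
    by have := k 1 ltr01; rewrite Q00 T00 mul0r !mulr0 mul0r; lra.
  have Tp0 : 0 < T by rewrite lt_neqAle eq_sym Tp.
  have := k (2 * T / N) ltac:(by rewrite divr_gt0 ?mulr_gt0).
  rewrite Q00 mul0r mulr0 add0r (_ : 4 * T / _ = 2 * N); first lra.
  by field; rewrite !gt_eqF.
have Qp0 : 0 < Q u0 by rewrite lt_neqAle eq_sym Qp.
(* This value of [kap] makes the first term equal to [2 * N], which leaves
   [N <= T * Q u0 / (b ^+ 2 * N)]. *)
have kp : 0 < 2 * b ^+ 2 * N / Q u0.
  by apply: divr_gt0 => //; apply: mulr_gt0 => //; exact: mulr_gt0.
have := k _ kp.
rewrite (_ : _ + _ = 2 * N + 2 * (T * Q u0 / (b ^+ 2 * N))); last first.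
  by field; rewrite b0 !gt_eqF.
move=> h; have : N <= T * Q u0 / (b ^+ 2 * N) by lra.
by rewrite ler_pdivlMr; [rewrite mulrCA -expr2|exact: mulr_gt0].
Qed.

End spread.

Theorem theorem1 (R : realType) (a b c d : R) (f g : R -> R[i]) :
  a * d - b * c = 1 -> b != 0 ->
  L2 f -> L2 g ->
  L2norm2 f != 0%E -> L2norm2 g != 0%E ->
  L2 (fun t => (t%:C)%C * f t) -> L2 (fun t => (t%:C)%C * g t) ->
  L2 (fun u => (u%:C)%C * LCT a b c d f u) ->
  L2 (fun u => (u%:C)%C * LCT a b c d g u) ->
  `|b| ^+ 2 <= Tspread2 a b c d g f * Fspread2 a b c d g f.
Proof.
move=> _ b0 fL gL f0 g0 fL1 gL1 fLu gLu.
have mom_gt0 (h : R -> R[i]) : L2 h -> L2 (fun t => (t%:C)%C * h t) -> L2norm2 h != 0%E ->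
    0 < moment (fun x => cmod (h x) ^+ 2) 0.
  move=> hL hL1 h0; have mh := cmeasurable_cmod2 (L2_cmeasurable hL).
  have h2 := L2_rmul_fin hL1.
  have E := moment0E mh (fun x => cmod2_ge0 (h x)) (L2_fin hL) h2.
  rewrite lt_neqAle; apply/andP; split.
    by apply: contraNneq h0 => m0; rewrite /L2norm2 E -m0.
  by rewrite -lee_fin -E; apply: ge0_int => x; exact: cmod2_ge0.
have [H N0] := spread_product b0 fL gL fL1 gL1 fLu gLu (mom_gt0 f fL fL1 f0) (mom_gt0 g gL gL1 g0)
  (tmean a b c d g f) (umean a b c d g f).
rewrite real_normK ?num_real// /Tspread2 /Fspread2 mulf_div -expr2.
by rewrite ler_pdivlMr// exprn_gt0.
Qed.
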